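(* Let $p$ be a prime, $q$ a power of $p$, and $k=\overline{\mathbb F}_p$. Let $G$ be one of the finite groups $$\mathsf{SL}_n(\mathbb F_q),\qquad \mathsf{Sp}_{2n}(\mathbb F_q),$$ or one of their twisted forms $${}^2\mathsf{SL}_n(\mathbb F_q),\qquad {}^2\mathsf{Sp}_{2n}(\mathbb F_q).$$ Let $V$ be a faithful representation of $G$ over $k$. Then the quotient $V/G$ is stably rational over $k$.
   Context: Representations are finite-dimensional. A $k$-variety $Y$ is stably rational if $Y\times\mathbb A^m$ is birational over $k$ to an affine space for some $m\ge 0$; for $Y=V/G$ this means that $k(V)^G(t_1,\dots,t_m)$ is purely transcendental over $k$ for some $m$. The twisted forms are the finite groups of fixed points $\mathsf G(k)^F$ of a twisted Frobenius map $F$ of $\mathsf G=\mathsf{SL}_n$ or $\mathsf{Sp}_{2n}$, in the usual sense of twisted groups of Lie type: ${}^2\mathsf{SL}_n(\mathbb F_q)$ is the special unitary group $\mathsf{SU}_n$ attached to $\mathbb F_{q^2}/\mathbb F_q$, and ${}^2\mathsf{Sp}_{2n}(\mathbb F_q)$ is understood whenever it exists (the Suzuki groups, for $n=2$ and $q$ an odd power of $2$). *)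

(* Defs.v *)
From HB Require Import structures.
From mathcomp Require Import all_boot all_order all_fingroup all_algebra.
From mathcomp Require Import all_solvable all_field all_character.
From mathcomp Require Import mpoly.

Set Implicit Arguments.
Unset Strict Implicit.
Unset Printing Implicit Defensive.

Import GRing.Theory.
Local Open Scope ring_scope.

Local Notation "x %:F" := (@FracField.tofrac _ x).
Local Notation repr := generic_quotient.repr.

Definition is_algebraic_closure_of_Fp (p : nat) (k : closedFieldType) : Prop :=
  exists iota : {rmorphism 'F_p -> k}, forall x : k, algebraicOver iota x.

Section MatrixGroups.

Definition special_linear (F : fieldType) (n : nat) (A : 'M[F]_n) : Prop :=
  \det A = 1.

Definition symplectic_form (F : fieldType) (n : nat) : 'M[F]_(n + n) :=
  block_mx 0 1%:M (- 1%:M) 0.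

Definition symplectic (F : fieldType) (n : nat) (A : 'M[F]_(n + n)) : Prop :=
  A^T *m symplectic_form F n *m A = symplectic_form F n.

(* To be used over a field with q ^ 2 elements, whose involution over the     *)
(* subfield with q elements is x |-> x ^+ q.                                  *)
Definition special_unitary (q : nat) (E : fieldType) (n : nat) (A : 'M[E]_n) :
    Prop :=
  A *m (map_mx (fun x => x ^+ q) A)^T = 1%:M /\ \det A = 1.

(* The exceptional isogeny of Sp_4 in characteristic 2: for the symplectic    *)
(* space W = <e0, e1, e2, e3> with <e0, e2> = <e1, e3> = 1, Sp(W) acts on the *)
(* 4-dimensional symplectic space w^perp / <w>, where w = e0 /\ e2 + e1 /\ e3 *)
(* in the exterior square of W.  The classes of e0 /\ e1, e0 /\ e3, e2 /\ e3  *)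
(* and e1 /\ e2 form a basis, whose first and third, and second and fourth,   *)
(* vectors are paired; in this basis the action of A is given by 2 x 2 minors *)
(* (signs are irrelevant in characteristic 2).  The square of the isogeny is  *)
(* the Frobenius map raising the entries to the power 2.                      *)
Definition wedge_basis (i : 'I_4) : 'I_4 * 'I_4 :=
  let e j : 'I_4 := inord j in
  tnth [tuple (e 0, e 1); (e 0, e 3); (e 2, e 3); (e 1, e 2)]%N i.

Definition Sp4_isogeny (F : fieldType) (A : 'M[F]_4) : 'M[F]_4 :=
  \matrix_(i, j)
    let: (i1, i2) := wedge_basis i in
    let: (j1, j2) := wedge_basis j in
    A i1 j1 * A i2 j2 - A i1 j2 * A i2 j1.

(* A twisted Frobenius map of Sp_4 in characteristic 2; its square raises the *)
(* entries to the power q = 2 ^ (2 * m + 1).                                  *)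
Definition Sp4_twisted_Frobenius (m : nat) (F : fieldType) (A : 'M[F]_4) :
    'M[F]_4 :=
  map_mx (fun x => x ^+ (2 ^ m)) (Sp4_isogeny A).

Definition suzuki (m : nat) (F : fieldType) (A : 'M[F]_4) : Prop :=
  symplectic (n := 2) A /\ Sp4_twisted_Frobenius m A = A.

Definition isomorphic_to_matrix_group (gT : finGroupType) (G : {group gT})
    (F : fieldType) (n : nat) (P : 'M[F]_n -> Prop) : Prop :=
  exists2 rho : mx_representation F G n,
    mx_faithful rho & forall A, P A <-> (exists2 g, g \in G & rho g = A).

Inductive SL_Sp_or_twisted (k : fieldType) (q : nat) (gT : finGroupType)
    (G : {group gT}) : Prop :=
| SL_case (F : finFieldType) (n : nat) of #|F| = q & (0 < n)%N &
    isomorphic_to_matrix_group G (@special_linear F n)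
| Sp_case (F : finFieldType) (n : nat) of #|F| = q & (0 < n)%N &
    isomorphic_to_matrix_group G (@symplectic F n)
| SU_case (E : finFieldType) (n : nat) of #|E| = (q ^ 2)%N & (0 < n)%N &
    isomorphic_to_matrix_group G (@special_unitary q E n)
(* k is the algebraic closure of the prime field: the group of fixed points   *)
(* is taken inside Sp_4(k).                                                   *)
| Suzuki_case (m : nat) of q = (2 ^ m.*2.+1)%N &
    isomorphic_to_matrix_group G (@suzuki m k).

End MatrixGroups.

Section FractionMap.

Variables R S : idomainType.

(* The extension to fraction fields of an injective ring morphism.            *)
Definition frac_map (f : R -> S) (x : {fraction R}) : {fraction S} :=
  (f \n_(repr x))%:F / (f \d_(repr x))%:F.

Lemma fracE (x : {fraction R}) : x = (\n_(repr x))%:F / (\d_(repr x))%:F.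
Proof.
have dx0 : (\d_(repr x))%:F != 0 by rewrite tofrac_eq0 denom_ratioP.
apply: (canRL (mulfK dx0)); case: (repr x) (generic_quotient.reprK x) => -[a b] /= b0 <-.
unlock FracField.tofrac; rewrite -[LHS]FracField.pi_mul.
apply/eqmodP; rewrite /= FracField.equivfE /FracField.mulf /=.
by rewrite !numden_Ratio ?mulr1 ?oner_neq0 // mulrC.
Qed.

Variables (f : {rmorphism R -> S}) (f_inj : injective f).

Lemma map_tofrac_neq0 (a : R) : a != 0 -> (f a)%:F != 0.
Proof. by rewrite tofrac_eq0 raddf_eq0. Qed.

Lemma frac_map_div (a b : R) : b != 0 ->
  frac_map f (a%:F / b%:F) = (f a)%:F / (f b)%:F.
Proof.
move=> b0; set x := a%:F / b%:F; rewrite /frac_map.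
have d0 := denom_ratioP (repr x).
have /eqP : x = _ := fracE x.
rewrite eqr_div ?tofrac_eq0 // -!tofracM tofrac_eq => /eqP E.
by apply/eqP; rewrite eqr_div ?map_tofrac_neq0 // -!tofracM -!rmorphM -E.
Qed.

Lemma frac_map_tofrac (a : R) : frac_map f a%:F = (f a)%:F.
Proof.
rewrite -[a%:F]divr1 -(tofrac1 R) frac_map_div ?oner_neq0 //.
by rewrite rmorph1 tofrac1 divr1.
Qed.

Lemma frac_mapB : {morph frac_map f : x y / x - y}.
Proof.
move=> x y; have dx0 := denom_ratioP (repr x); have dy0 := denom_ratioP (repr y).
rewrite [x in frac_map f (x - _)]fracE [y in frac_map f (_ - y)]fracE.
rewrite -mulNr addf_div ?tofrac_eq0 //.
rewrite -tofracN -!tofracM -tofracD frac_map_div ?mulf_neq0 //.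
rewrite /frac_map -mulNr addf_div ?map_tofrac_neq0 //.
by rewrite rmorphD !rmorphM !rmorphN !(tofracD, tofracM, tofracN).
Qed.

Lemma frac_map_divM : {morph frac_map f : x y / x / y}.
Proof.
move=> x y; have dx0 := denom_ratioP (repr x); have dy0 := denom_ratioP (repr y).
have [->|y0] := eqVneq y 0.
  by rewrite -(tofrac0 R) frac_map_tofrac !rmorph0 !invr0 !mulr0
    -(tofrac0 R) frac_map_tofrac rmorph0.
have ny0 : \n_(repr y) != 0.
  by apply: contraNneq y0 => n0; rewrite [y]fracE n0 tofrac0 mul0r.
rewrite [x in frac_map f (x / _)]fracE [y in frac_map f (_ / y)]fracE.
rewrite invf_div mulf_div -!tofracM frac_map_div ?mulf_neq0 //.
by rewrite /frac_map invf_div mulf_div -!tofracM -!rmorphM.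
Qed.

End FractionMap.

Section Subfield.

Variables (L : fieldType) (S : divringClosed L).

Record subfield_of : Type := SubfieldOf {
  subfield_val :> L;
  _ : subfield_val \in S }.

HB.instance Definition _ := [isSub for subfield_val].
HB.instance Definition _ := [Choice of subfield_of by <:].
HB.instance Definition _ :=
  [SubChoice_isSubIntegralDomain of subfield_of by <:].
HB.instance Definition _ :=
  [SubIntegralDomain_isSubField of subfield_of by <:].

End Subfield.

Section InvariantField.

Variables (k : fieldType) (gT : finGroupType) (G : {group gT}) (d : nat).
Variable rV : mx_representation k G d.

(* Polynomial functions on V = k^d (row vectors, on which mathcomp's          *)
(* representations act from the right): the action of g maps f to the         *)
(* function v |-> f (v *m rV g).                                              *)
Definition polyfun_act (g : gT) (f : {mpoly k[d]}) : {mpoly k[d]} :=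
  f \mPo [tuple \sum_i rV g i j *: 'X_i | j < d].

HB.instance Definition _ (g : gT) := GRing.RMorphism.copy (polyfun_act g)
  (comp_mpoly [tuple \sum_i rV g i j *: 'X_i | j < d]).

Lemma polyfun_act_meval g f (v : 'rV[k]_d) :
  (polyfun_act g f).@[fun i => v 0 i] = f.@[fun i => (v *m rV g) 0 i].
Proof.
rewrite comp_mpoly_meval; apply: meval_eq => j.
rewrite tnth_mktuple raddf_sum mxE; apply: eq_bigr => i _.
by rewrite /= mevalZ mevalXU mulrC.
Qed.

Lemma polyfun_act_comp g h f : g \in G -> h \in G ->
  polyfun_act g (polyfun_act h f) = polyfun_act (g * h)%g f.
Proof.
move=> Gg Gh; rewrite /polyfun_act; elim/mpolyind: f => [|c m p _ _ IHp].
  by rewrite !comp_mpoly0.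
rewrite !comp_mpolyD IHp; apply: (congr1 (fun u => u + _)).
rewrite !comp_mpolyZ !comp_mpolyX rmorph_prod; congr (_ *: _).
apply: eq_bigr => j _; rewrite rmorphXn; congr (_ ^+ _).
rewrite !tnth_mktuple raddf_sum repr_mxM //=.
under eq_bigr => i _.
  rewrite /= comp_mpolyZ comp_mpolyXU -tnth_nth tnth_mktuple scaler_sumr.
  under eq_bigr => l _ do rewrite scalerA.
  over.
rewrite exchange_big; apply: eq_bigr => i _ /=.
by rewrite mxE scaler_suml; apply: eq_bigr => l _; rewrite mulrC.
Qed.

Lemma polyfun_act1 f : polyfun_act 1%g f = f.
Proof.
rewrite -[RHS]comp_mpoly_id; congr (f \mPo _); apply: eq_from_tnth => j.
rewrite !tnth_mktuple repr_mx1 (bigD1 j) //= mxE eqxx scale1r big1 ?addr0 //.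
by move=> i ij; rewrite mxE (negPf ij) scale0r.
Qed.

Lemma polyfun_act_inj g : g \in G -> injective (polyfun_act g).
Proof.
move=> Gg; apply: (can_inj (g := polyfun_act g^-1%g)) => f.
by rewrite polyfun_act_comp ?groupV // mulVg polyfun_act1.
Qed.

(* k(V) is {fraction {mpoly k[d]}}.                                           *)
Definition invariant_rational : {pred {fraction {mpoly k[d]}}} :=
  fun f => [forall g in G, frac_map (polyfun_act g) f == f].

Lemma invariant_rational_divring_closed : divring_closed invariant_rational.
Proof.
split=> [|x y /forall_inP Ix /forall_inP Iy|x y /forall_inP Ix /forall_inP Iy].
- apply/forall_inP => g /polyfun_act_inj g_inj.
  by rewrite -(tofrac1 {mpoly k[d]}) frac_map_tofrac ?rmorph1.
- apply/forall_inP => g Gg; rewrite frac_mapB; last exact: polyfun_act_inj.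
  by rewrite (eqP (Ix g Gg)) (eqP (Iy g Gg)).
- apply/forall_inP => g Gg; rewrite frac_map_divM; last exact: polyfun_act_inj.
  by rewrite (eqP (Ix g Gg)) (eqP (Iy g Gg)).
Qed.

HB.instance Definition _ := GRing.isDivringClosed.Build
  {fraction {mpoly k[d]}} invariant_rational invariant_rational_divring_closed.

(* The field k(V)^G.                                                          *)
Definition invariant_field : fieldType := subfield_of invariant_rational.

Lemma invariant_constP (c : k) : (c%:MP_[d])%:F \in invariant_rational.
Proof.
apply/forall_inP => g /polyfun_act_inj g_inj.
rewrite frac_map_tofrac //; apply/eqP; congr (_%:F).
exact: comp_mpolyC.
Qed.

Definition invariant_const (c : k) : invariant_field :=
  SubfieldOf (invariant_constP c).

End InvariantField.

(* L, with its k-algebra structure given by iota, is isomorphic over k to a   *)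
(* field of rational functions k(x_1, ..., x_n).                              *)
Definition purely_transcendental (k L : fieldType) (iota : k -> L) : Prop :=
  exists (n : nat) (phi : {rmorphism {fraction {mpoly k[n]}} -> L}),
    bijective phi /\ forall c : k, phi (c%:MP_[n])%:F = iota c.

(* Stable rationality over k of the quotient V / G, i.e., for some m the      *)
(* field k(V)^G(t_1, ..., t_m) is purely transcendental over k.               *)
Definition quotient_stably_rational (k : fieldType) (gT : finGroupType)
    (G : {group gT}) (d : nat) (rV : mx_representation k G d) : Prop :=
  exists m : nat,
    purely_transcendental (L := {fraction {mpoly (invariant_field rV)[m]}})
      (fun c => ((invariant_const rV c)%:MP_[m])%:F).

(* Main.v *)
From HB Require Import structures.
Require Import Defs.
From mathcomp Require Import all_boot all_order all_fingroup all_algebra.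
From mathcomp Require Import all_solvable all_field all_character.
From mathcomp Require Import ring mpoly.
From Stdlib Require Import Classical ClassicalEpsilon.

(* Let K = k(V), and let X be a generic n x n matrix, on which G acts through  *)
(* its natural representation rho by X |-> X rho(g). By Speiser's theorem both *)
(* k(V)(t_ij) and k(V + M_n) are, up to G-invariant changes of variables, the  *)
(* same field with G-action, so k(V)^G(t_ij) = k(V + M_n)^G = k(M_n)^G(s_1,    *)
(* ..., s_d), and it remains to see that k(M_n)^G is purely transcendental.    *)
(*                                                                             *)
(* Let F be the Frobenius map of the finite field of definition. In each case  *)
(* there are invariants that determine X up to the finite group (Lang's        *)
(* theorem):                                                                   *)
(*  - det X and Y = F(X) X^-1 for SL_n, where det Y = (det X)^(q - 1);         *)
(*  - det X and H = X F(X)^T for SU_n, where det H = (det X)^(q + 1);          *)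
(*  - T = X J X^T and Y = F(X) X^-1 for Sp_2n, where F(T) = Y T Y^T;           *)
(*  - T = X J X^T and W = sigma(Z) Z^-1 for the Suzuki groups, where Z is the  *)
(*    product of X by a matrix over k(T) that makes it symplectic.             *)
(* They generate the invariants because any conjugate of X is X C with C in    *)
(* the group. The relations between them are linear in one row of the matrix   *)
(* once the other rows are known, so n^2 of them generate, which is the        *)
(* transcendence degree; hence these n^2 generators are independent.           *)

Set Implicit Arguments.
Unset Strict Implicit.
Unset Printing Implicit Defensive.

Import GRing.Theory.
Local Open Scope ring_scope.

Local Notation "x %:F" := (@FracField.tofrac _ x).
Local Notation repr := generic_quotient.repr.

(** * Algebraic dependence *)

(** Let K = k(V) and E = K(t_ij) with n * n new variables fixed by G. The fixed field of E is
    k(V)^G(t_ij) ([frac_mpoly_fixed]), so it suffices to find free generators of E^G over k.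
    [speiser] over k(V) turns the matrix T of the t_ij into X = T B with g(X) = X rho(g). Applied
    again over k(X), on which G acts faithfully, it turns the coordinate vector of V into an
    invariant vector V'. As E is generated over k by X and V', only the invariants of X remain to be
    found. This is [lang_data_transcendental].

    [lang_data] isolates what is asked of the group: at most n * n invariants over which F(X) = Y X,
    and such that every matrix C over the finite field for which X C is a specialization of X comes
    from G. No Galois closure is formed. [lang_descent] studies the functions C |-> P(X C) on the
    finite set of matrices C: the equation F(X) = Y X reduces them to finitely many monomials,
    independent over E, and membership in the subfield becomes linear algebra.

    Independence of the generators comes from counting: E is algebraic over the subfield they
    generate ([power_matrix_algebraic]), and they are at most d + n * n in number, which is the
    transcendence degree of E ([steinitz], [alg_indep_of_size]). The bound n * n is met in each
    family by solving linear equations row by row ([gen_matrix_det], [gen_matrix_gram],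
    [gen_alternating]). *)

Section GeneratedSubfield.

Variable E : fieldType.
Implicit Types (S A : E -> Prop) (x y z : E).

Inductive gen S : E -> Prop :=
| gen_in x of S x : gen S x
| gen1 : gen S 1
| genB x y of gen S x & gen S y : gen S (x - y)
| gen_div x y of gen S x & gen S y : gen S (x / y).

Lemma gen0 S : gen S 0.
Proof. by rewrite -(subrr 1); apply: genB; apply: gen1. Qed.
Lemma genN S x : gen S x -> gen S (- x).
Proof. by rewrite -sub0r; apply: genB; apply: gen0. Qed.
Lemma genD S x y : gen S x -> gen S y -> gen S (x + y).
Proof. by move=> gx /genN; rewrite -{2}[y]opprK; apply: genB. Qed.
Lemma genV S x : gen S x -> gen S x^-1.
Proof. by rewrite -div1r; apply: gen_div; apply: gen1. Qed.
Lemma genM S x y : gen S x -> gen S y -> gen S (x * y).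
Proof. by move=> gx /genV; rewrite -{2}[y]invrK; apply: gen_div. Qed.
Lemma genX S x n : gen S x -> gen S (x ^+ n).
Proof.
move=> gx; elim: n => [|n IHn]; first exact: gen1.
by rewrite exprS; apply: genM.
Qed.
Lemma gen_sum S (I : Type) (r : seq I) (P : pred I) (F : I -> E) :
  (forall i, P i -> gen S (F i)) -> gen S (\sum_(i <- r | P i) F i).
Proof. by apply: (big_ind (gen S)) => //; [exact: gen0|exact: genD]. Qed.
Lemma gen_prod S (I : Type) (r : seq I) (P : pred I) (F : I -> E) :
  (forall i, P i -> gen S (F i)) -> gen S (\prod_(i <- r | P i) F i).
Proof. by apply: (big_ind (gen S)) => //; [exact: gen1|exact: genM]. Qed.

Lemma gen_trans S A x : (forall z, S z -> gen A z) -> gen S x -> gen A x.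
Proof.
move=> h; elim=> [z /h //||a b _ ga _ gb|a b _ ga _ gb].
- exact: gen1.
- exact: genB.
- exact: gen_div.
Qed.

Lemma gen_mono S A x : (forall z, S z -> A z) -> gen S x -> gen A x.
Proof. by move=> h; apply: gen_trans => z /h; apply: gen_in. Qed.

Definition gen_pred S : {pred E} :=
  fun x => if excluded_middle_informative (gen S x) then true else false.

Lemma gen_predP S x : reflect (gen S x) (x \in gen_pred S).
Proof.
by rewrite unfold_in /gen_pred; case: excluded_middle_informative => h; constructor.
Qed.

Lemma gen_pred_divring_closed S : divring_closed (gen_pred S).
Proof.
split=> [|x y /gen_predP gx /gen_predP gy|x y /gen_predP gx /gen_predP gy];
  apply/gen_predP; [exact: gen1|exact: genB|exact: gen_div].
Qed.

HB.instance Definition _ S := GRing.isDivringClosed.Build E (gen_pred S)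
  (gen_pred_divring_closed S).

(** Excluded middle makes [gen S] a boolean predicate, so it can be packed as a field; polynomials
    and matrices over the generated subfield are then those over [M]. *)
Lemma gen_field S : exists (M : fieldType) (iota : {rmorphism M -> E}),
  forall x, gen S x <-> exists a, iota a = x.
Proof.
exists (subfield_of (gen_pred S)), \val => x; split=> [/gen_predP Sx|[a <-]].
  by exists (SubfieldOf Sx).
by apply/gen_predP; apply: valP.
Qed.

Definition algebraic_in S x :=
  exists2 p : {poly E}, p != 0 & root p x /\ forall i, gen S p`_i.

Section Fractions.

Variables (S : E -> Prop) (R : comNzRingType) (ev : {rmorphism R -> E}).
Hypothesis evS : forall z, S z -> exists a, ev a = z.

Lemma gen_frac z : gen S z -> exists p q, ev q != 0 /\ z = ev p / ev q.
Proof.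
elim=> [y /evS[a <-]||a b _ [p [q [q0 ->]]] _ [p' [q' [q'0 ->]]]
       |a b _ [p [q [q0 ->]]] _ [p' [q' [q'0 ->]]]].
- by exists a, 1; rewrite rmorph1 oner_neq0 divr1.
- by exists 1, 1; rewrite rmorph1 oner_neq0 divr1.
- exists (p * q' - p' * q), (q * q'); rewrite rmorphB !rmorphM /= mulf_neq0 //.
  by split=> //; field; apply/andP.
(* Division by zero gives 0, which needs its own fraction. *)
- have [p'0|p'0] := eqVneq (ev p') 0.
    by exists 0, 1; rewrite p'0 rmorph0 rmorph1 oner_neq0 !mul0r invr0 mulr0.
  exists (p * q'), (q * p'); rewrite !rmorphM /= mulf_neq0 //; split=> //.
  by field; apply/and3P.
Qed.

Lemma gen_frac_poly (p : {poly E}) : (forall i, gen S p`_i) ->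
  exists (r : {poly R}) (d : R), ev d != 0 /\ map_poly ev r = ev d *: p.
Proof.
elim/poly_ind: p => [|p c IHp] gp.
  by exists 0, 1; rewrite rmorph1 oner_neq0 rmorph0 scaler0.
have [i|r [d [d0 rE]]] := IHp.
  by have := gp i.+1; rewrite coefD coefMX coefC /= addr0.
have := gp 0%N; rewrite coefD coefMX coefC /= add0r => /gen_frac[u [v [v0 ->]]].
exists (r * 'X * v%:P + (u * d)%:P), (d * v); rewrite rmorphM /= mulf_neq0 //.
split=> //; rewrite rmorphD !rmorphM /= map_polyX !map_polyC rE /=.
rewrite scalerDr; congr (_ + _).
  by rewrite mulrC mul_polyC -scalerAl scalerA mulrC.
by rewrite -mul_polyC -!polyCM; congr (_%:P); field.
Qed.

End Fractions.

Section Presentation.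

Variables (S : E -> Prop) (M : fieldType) (iota : {rmorphism M -> E}).
Hypothesis genE : forall x, gen S x <-> exists a, iota a = x.

Lemma gen_lift_poly (p : {poly E}) : (forall i, gen S p`_i) ->
  exists q : {poly M}, map_poly iota q = p.
Proof.
elim/poly_ind: p => [|p c IHp] gp; first by exists 0; rewrite rmorph0.
have [i|q qE] := IHp; first by have := gp i.+1; rewrite coefD coefMX coefC /= addr0.
have := gp 0%N; rewrite coefD coefMX coefC /= add0r => /genE[a aE].
by exists (q * 'X + a%:P); rewrite rmorphD rmorphM /= map_polyX map_polyC qE -aE.
Qed.

Lemma algebraic_in_over x : algebraic_in S x <-> algebraicOver iota x.
Proof.
split=> [[p p0 [rp /gen_lift_poly[q qE]]]|[p p0 rp]].
  by exists q; rewrite ?qE // -(map_poly_eq0 iota) qE.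
exists (map_poly iota p); first by rewrite map_poly_eq0.
by split=> // i; rewrite coef_map; apply/genE; exists p`_i.
Qed.

Definition at_point x (p : {poly M}) : E := (map_poly iota p).[x].
HB.instance Definition _ x := GRing.RMorphism.copy (at_point x)
  (horner_eval x \o map_poly iota).

Definition adjoin x : E -> Prop := fun z => S z \/ z = x.

Lemma gen_at_point x (p : {poly M}) : gen (adjoin x) (at_point x p).
Proof.
rewrite /at_point horner_coef; apply: gen_sum => i _.
rewrite coef_map; apply: genM.
  have : gen S (iota p`_i) by apply/genE; exists p`_i.
  by apply: gen_mono => z; left.
by apply: genX; apply: gen_in; right.
Qed.

Lemma at_point_adjoin x z : adjoin x z -> exists p, at_point x p = z.
Proof.
case=> [/gen_in/genE[a <-]|->].
  by exists a%:P; rewrite /at_point map_polyC hornerC.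
by exists 'X; rewrite /at_point map_polyX hornerX.
Qed.

End Presentation.

Lemma algebraic_in_gen S x : gen S x -> algebraic_in S x.
Proof.
have [M [iota genE]] := gen_field S.
by move=> /genE[a <-]; apply/(algebraic_in_over genE)/algebraic_id.
Qed.

Lemma algebraic_in_trans S A x :
  (forall z, A z -> algebraic_in S z) -> algebraic_in A x -> algebraic_in S x.
Proof.
have [M [iota genE]] := gen_field S; have algE := algebraic_in_over genE.
move=> h [p p0 [rp gp]]; apply/algE/integral_algebraic.
have gA z : gen A z -> algebraicOver iota z.
  elim=> [y /h/algE //||a b _ ga _ gb|a b _ ga _ gb].
  - exact: algebraic1.
  - exact: algebraic_sub.
  - exact: algebraic_div.
apply: (integral_root p0 rp) => _ /(nthP 0)[i _ <-]; apply/integral_algebraic.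
exact/gA/gp.
Qed.

Lemma algebraic_in_mono S A x :
  (forall z, S z -> A z) -> algebraic_in S x -> algebraic_in A x.
Proof.
move=> h; apply: algebraic_in_trans => z /h Az.
by apply: algebraic_in_gen; apply: gen_in.
Qed.

(** Clearing denominators in the equation of x over S(y) gives a bivariate relation r(y, x) = 0.
    Read as a polynomial in y it is nonzero: one of its coefficients is a nonzero polynomial in x
    over S, which cannot vanish as x is transcendental. *)
Lemma algebraic_in_exchange S x y :
  algebraic_in (adjoin S y) x -> ~ algebraic_in S x ->
  algebraic_in (adjoin S x) y.
Proof.
have [M [iota genE]] := gen_field S; have algE := algebraic_in_over genE.
move=> [p p0 [rp gp]] nx.
have [r [d [d0 rE]]] := gen_frac_poly (@at_point_adjoin _ _ _ genE y) gp.
have r0 : r != 0.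
  by apply: contraNneq p0 => r0; move/eqP: rE;
    rewrite r0 rmorph0 eq_sym scaler_eq0 (negPf d0).
have [j sj] : exists j, (swapXY r)`_j != 0.
  exists (size (swapXY r)).-1; rewrite -lead_coefE lead_coef_eq0.
  by rewrite swapXY_eq0.
exists (map_poly (at_point iota x) (swapXY r)).
  apply/eqP => /polyP/(_ j)/eqP; rewrite coef_map coef0 => /eqP s0; apply: nx.
  by apply/algE; exists (swapXY r)`_j => //; apply/rootP.
split=> [|i]; last by rewrite coef_map; apply: gen_at_point.
have polyE a b (u : {poly {poly M}}) :
    (map_poly (at_point iota a) u).[b] = (map_poly (map_poly iota) u).[b, a].
  rewrite -{2}(hornerC b a) -[RHS]/(horner_eval a _) -horner_map -map_poly_comp.
  by rewrite /= /horner_eval !hornerC.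
rewrite /root polyE -swapXY_map horner2_swapXY -polyE rE hornerZ.
by rewrite (rootP rp) mulr0.
Qed.

Definition adjoins S (xs : seq E) : E -> Prop := fun z => S z \/ z \in xs.

Fixpoint alg_indep S (xs : seq E) : Prop :=
  if xs is x :: xs' then ~ algebraic_in S x /\ alg_indep (adjoin S x) xs'
  else True.

Lemma adjoins_cons S x xs z : adjoins S (x :: xs) z <-> adjoins (adjoin S x) xs z.
Proof.
rewrite /adjoins /adjoin inE; split=> [[h|/predU1P[->|h]]|[[h|->]|h]].
- by left; left.
- by left; right.
- by right.
- by left.
- by right; rewrite eqxx.
- by right; rewrite h orbT.
Qed.

Lemma adjoins_nil S z : adjoins S [::] z <-> S z.
Proof. by rewrite /adjoins in_nil; split=> [[]|]; [| |left]. Qed.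

Lemma alg_indep_rcons S xs x : alg_indep S (rcons xs x) <->
  alg_indep S xs /\ ~ algebraic_in (adjoins S xs) x.
Proof.
elim: xs S => [|y xs IHxs] S /=.
  by split=> [[h _]|[_ h]]; split=> //; apply: contra_not h;
    apply: algebraic_in_mono => z /adjoins_nil.
rewrite IHxs; split=> [[h1 [h2 h3]]|[[h1 h2] h3]].
  by split=> //; apply: contra_not h3; apply: algebraic_in_mono => z /adjoins_cons.
split=> //; split=> //.
by apply: contra_not h3; apply: algebraic_in_mono => z /adjoins_cons.
Qed.

Lemma algebraic_in_base S x : S x -> algebraic_in S x.
Proof. by move=> Sx; apply: algebraic_in_gen; apply: gen_in. Qed.

(** The element x takes the place of the first member of [ys] whose adjunction makes x algebraic. *)
Lemma steinitz_exchange S x ys :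
  algebraic_in (adjoins S ys) x -> ~ algebraic_in S x ->
  exists2 ys', (size ys').+1 = size ys &
    forall z, adjoins S ys z -> algebraic_in (adjoins (adjoin S x) ys') z.
Proof.
elim: ys S => [|y ys IHys] S xS nx.
  by case: nx; apply: algebraic_in_mono xS => z /adjoins_nil.
have {}xS : algebraic_in (adjoins (adjoin S y) ys) x.
  by apply: algebraic_in_mono xS => z /adjoins_cons.
case: (excluded_middle_informative (algebraic_in (adjoin S y) x)) => [yx|nyx].
  have xy := algebraic_in_exchange yx nx; exists ys => // z.
  move=> /adjoins_cons[[Sz|->]|zys]; last by apply: algebraic_in_base; right.
    by apply: algebraic_in_base; left; left.
  by apply: algebraic_in_mono xy => w xw; left.
have [ys' sz h] := IHys _ xS nyx; exists (y :: ys') => [|z]; first by rewrite /= sz.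
move=> /adjoins_cons/h.
apply: algebraic_in_mono => w [[[Sw|->]|->]|wys'].
- by left; left.
- by right; rewrite mem_head.
- by left; right.
- by right; rewrite inE wys' orbT.
Qed.

Lemma steinitz S xs ys : alg_indep S xs ->
  (forall x, x \in xs -> algebraic_in (adjoins S ys) x) -> (size xs <= size ys)%N.
Proof.
elim: xs S ys => [|x xs IHxs] S ys //= [nx ixs] hxs.
have [ys' <- h] := steinitz_exchange (hxs x (mem_head _ _)) nx.
rewrite ltnS; apply: IHxs ixs _ => z zxs.
by apply: (algebraic_in_trans h); apply: hxs; rewrite inE zxs orbT.
Qed.

Lemma alg_indep_or_shrink S ys : alg_indep S ys \/
  exists2 ys', (size ys' < size ys)%N &
    forall z, adjoins S ys z -> algebraic_in (adjoins S ys') z.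
Proof.
elim: ys S => [|y ys IHys] S; first by left.
case: (excluded_middle_informative (algebraic_in S y)) => [ay|nay].
  right; exists ys => // z /adjoins_cons[[Sz|->]|zys].
  - by apply: algebraic_in_base; left.
  - by apply: algebraic_in_mono ay => w; left.
  - by apply: algebraic_in_base; right.
have [iys|[ys' ltys h]] := IHys (adjoin S y); first by left.
right; exists (y :: ys') => // z /adjoins_cons/h.
by apply: algebraic_in_mono => w /adjoins_cons.
Qed.

(** A dependent [ys] could be shortened with the same algebraic closure, against [steinitz]. This
    turns a count of generators into their independence. *)
Lemma alg_indep_of_size S xs ys : alg_indep S xs -> (size ys <= size xs)%N ->
  (forall x, x \in xs -> algebraic_in (adjoins S ys) x) -> alg_indep S ys.
Proof.
move=> ixs leyx hxs; have [//|[ys' ltys h]] := alg_indep_or_shrink S ys.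
suff : (size xs <= size ys')%N.
  by move/(leq_trans leyx); rewrite leqNgt ltys.
by apply: steinitz ixs _ => x /hxs; apply: algebraic_in_trans.
Qed.

(** * Independence as the absence of polynomial relations *)

Section PolynomialRelations.

Variables (k : fieldType) (iota : {rmorphism k -> E}).

Definition constant z : Prop := exists c, iota c = z.

Definition relation_free n (y : 'I_n -> E) : Prop :=
  forall P : {mpoly k[n]}, mmap iota y P = 0 -> P = 0.

Local Notation widen := (widen_ord (leqnSn _)).

Lemma mmap_muni n (y : 'I_n.+1 -> E) (P : {mpoly k[n.+1]}) :
  mmap iota y P =
  (map_poly (mmap iota (fun i => y (widen i))) (muni P)).[y ord_max].
Proof.
elim/mpolyind: P => [|c m P _ _ IHP]; first by rewrite muni0 !raddf0 horner0.
rewrite muniD raddfD /= IHP raddfD hornerD; congr (_ + _).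
rewrite mmapZ muniZ /=.
rewrite -mul_polyC rmorphM /= map_polyC hornerM hornerC /= mmapC; congr (_ * _).
rewrite mmapX muniE msuppX big_seq1 mcoeffX eqxx scale1r.
rewrite -mul_polyC rmorphM /= map_polyC map_polyXn hornerM hornerC hornerXn /=.
rewrite mmapX /mmap1 big_ord_recr /=; congr (_ * _).
by apply: eq_bigr => i _; rewrite mnmE.
Qed.

Lemma muni_widen n (q : {mpoly k[n]}) : muni (mwiden q) = q%:P.
Proof.
elim/mpolyind: q => [|c m P _ _ IHP]; first by rewrite mwiden0 muni0.
rewrite mwidenD muniD IHP polyCD; congr (_ + _).
rewrite mwidenZ muniZ mwidenX muniE msuppX big_seq1 mcoeffX eqxx scale1r.
rewrite mnmwiden_ordmax expr0 alg_polyC -mul_polyC -polyCM mul_mpolyC.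
congr (_ *: 'X_[_])%:P; apply/mnmP => i; rewrite mnmE; exact: mnmwiden_widen.
Qed.

Lemma muni_ordmax n : muni ('X_ord_max : {mpoly k[n.+1]}) = 'X.
Proof.
rewrite muniE msuppX big_seq1 mcoeffX eqxx scale1r mnm1E eqxx expr1.
rewrite -[RHS]scale1r -mpolyX0; congr ('X_[_] *: _); apply/mnmP => i.
by rewrite mnmE mnm1E mnm0E eq_sym -val_eqE /= ltn_eqF.
Qed.

Lemma muniK n (r : {poly {mpoly k[n]}}) : exists P : {mpoly k[n.+1]}, muni P = r.
Proof.
elim/poly_ind: r => [|r c [P PE]]; first by exists 0; rewrite raddf0.
exists (P * 'X_ord_max + mwiden c).
by rewrite raddfD /= muniM PE muni_ordmax muni_widen.
Qed.

(** Substituting the last variable back is a left inverse of [muni]. *)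
Lemma muni_eq0 n (P : {mpoly k[n.+1]}) : muni P = 0 -> P = 0.
Proof.
pose f : {poly {mpoly k[n]}} -> {mpoly k[n.+1]} :=
  fun r => (map_poly (@mwiden n k) r).['X_ord_max].
suff fK Q : f (muni Q) = Q by move=> /(congr1 f); rewrite fK /f rmorph0 horner0.
elim/mpolyind: Q => [|c m Q _ _ IHQ]; first by rewrite muni0 /f rmorph0 horner0.
have fD u v : f (u + v) = f u + f v by rewrite /f rmorphD hornerD.
have fX : f (muni (c *: 'X_[m])) = c *: 'X_[m].
  rewrite /f muniZ -mul_polyC rmorphM /= map_polyC hornerM hornerC /= mwidenC.
  rewrite mul_mpolyC muniE msuppX big_seq1 mcoeffX eqxx scale1r -mul_polyC.
  rewrite rmorphM /= map_polyC map_polyXn hornerM hornerC hornerXn /= mwidenX.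
  rewrite mpolyXn -mpolyXD; congr (_ *: 'X_[_]); apply/mnmP => i.
  rewrite mnmDE mulmnE mnm1E; have [->|ni] := eqVneq i ord_max.
    by rewrite mnmwiden_ordmax mul1n.
  have lti : (i < n)%N by rewrite ltn_neqAle -ltnS ltn_ord andbT -val_eqE in ni *.
  have -> : i = widen (Ordinal lti) by apply/val_inj.
  by rewrite mnmwiden_widen mnmE mul0n addn0.
exact: (etrans (congr1 f (muniD _ _)) (etrans (fD _ _) (congr2 +%R fX IHQ))).
Qed.

Lemma adjoin_mmap n (y : 'I_n -> E) z :
  adjoins constant [seq y i | i <- enum 'I_n] z -> exists P, mmap iota y P = z.
Proof.
case=> [[c <-]|/mapP[i _ ->]]; first by exists c%:MP; rewrite mmapC.
by exists 'X_i; rewrite mmapX mmap1U.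
Qed.

Lemma gen_mmap n (y : 'I_n -> E) P :
  gen (adjoins constant [seq y i | i <- enum 'I_n]) (mmap iota y P).
Proof.
rewrite /mmap; apply: gen_sum => m _; apply: genM.
  by apply: gen_in; left; exists P@_m.
apply: gen_prod => i _; apply: genX; apply: gen_in; right.
by apply: map_f; rewrite mem_enum.
Qed.

(** Induction on the number of variables: through [muni] a relation becomes a univariate equation
    for the last element whose coefficients are polynomials in the others; conversely, an equation
    over the generated subfield becomes a relation once denominators are cleared. *)
Lemma relation_freeP n (y : 'I_n -> E) :
  relation_free y <-> alg_indep constant [seq y i | i <- enum 'I_n].
Proof.
elim: n y => [|n IHn] y.
  rewrite (size0nil (size_enum_ord 0)); split=> // _ P.
  have -> : P = (P@_0)%:MP.
    apply/mpolyP => m; rewrite mcoeffC.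
    by rewrite (_ : m = 0%MM) ?eqxx ?mulr1 //; apply/mnmP => -[].
  by rewrite mmapC => /eqP; rewrite fmorph_eq0 => /eqP->; rewrite mpolyC0.
pose y' (i : 'I_n) := y (widen i).
have -> : [seq y i | i <- enum 'I_n.+1] =
    rcons [seq y' i | i <- enum 'I_n] (y ord_max).
  by rewrite enum_ordSr map_rcons -map_comp.
rewrite alg_indep_rcons -IHn; split=> [fy|[fy' ny] P].
  split=> [P P0|[p p0 [rp gp]]].
    have [Q QE] := muniK P%:P; have : Q = 0.
      by apply: fy; rewrite mmap_muni QE map_polyC hornerC.
    by move=> Q0; move: QE; rewrite Q0 raddf0 => /esym/eqP; rewrite polyC_eq0 => /eqP.
  have [r [d [d0 rE]]] := gen_frac_poly (@adjoin_mmap _ _) gp.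
  have [Q QE] := muniK r.
  have Q0 : Q = 0 by apply: fy; rewrite mmap_muni QE rE hornerZ (rootP rp) mulr0.
  move: rE p0; rewrite -QE Q0 !raddf0 => /esym/eqP.
  by rewrite scaler_eq0 (negPf d0) /= => ->.
rewrite mmap_muni => P0; apply: muni_eq0; apply/polyP => i; rewrite coef0.
apply: fy'; apply/eqP; case: eqP => // /eqP ci0; case: ny.
exists (map_poly (mmap iota y') (muni P)); last first.
  by split=> [|j]; [apply/rootP|rewrite coef_map; apply: gen_mmap].
by apply: contra_neq ci0 => /polyP/(_ i); rewrite coef_map coef0.
Qed.

End PolynomialRelations.

End GeneratedSubfield.

(** * Fraction fields of polynomial rings *)

Lemma frac_lift (R : idomainType) (K : fieldType) (f : {rmorphism R -> K}) :
  injective f ->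
  exists phi : {rmorphism {fraction R} -> K}, forall a, phi a%:F = f a.
Proof.
move=> f_inj; pose phi (x : {fraction R}) := f \n_(repr x) / f \d_(repr x).
have f0 b : b != 0 -> f b != 0 by rewrite raddf_eq0.
have phi_div a b : b != 0 -> phi (a%:F / b%:F) = f a / f b.
  move=> b0; set x := a%:F / b%:F; rewrite /phi.
  have d0 := denom_ratioP (repr x).
  have /eqP : x = _ := fracE x.
  rewrite eqr_div ?tofrac_eq0 // -!tofracM tofrac_eq => /eqP h.
  by apply/eqP; rewrite eqr_div ?f0 // -!rmorphM -h.
have phiF a : phi a%:F = f a.
  by rewrite -[a%:F]divr1 -(tofrac1 R) phi_div ?oner_neq0 // rmorph1 divr1.
have phiB : zmod_morphism phi.
  move=> x y; have dx0 := denom_ratioP (repr x).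
  have dy0 := denom_ratioP (repr y).
  rewrite [x in phi (x - _)]fracE [y in phi (_ - y)]fracE.
  rewrite -mulNr addf_div ?tofrac_eq0 // -tofracN -!tofracM -tofracD.
  rewrite phi_div ?mulf_neq0 // /phi -mulNr addf_div ?f0 //.
  by rewrite rmorphD !rmorphM rmorphN.
have phiM : monoid_morphism phi.
  split=> [|x y]; first by rewrite -(tofrac1 R) phiF rmorph1.
  have dx0 := denom_ratioP (repr x); have dy0 := denom_ratioP (repr y).
  rewrite [x in phi (x * _)]fracE [y in phi (_ * y)]fracE mulf_div -!tofracM.
  by rewrite phi_div ?mulf_neq0 // /phi mulf_div !rmorphM.
pose phiP : {rmorphism {fraction R} -> K} := HB.pack phi
  (GRing.isZmodMorphism.Build _ _ phi phiB)
  (GRing.isMonoidMorphism.Build _ _ phi phiM).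
by exists phiP.
Qed.

Lemma frac_ind (R : idomainType) (x : {fraction R}) :
  exists a b : R, b != 0 /\ x = a%:F / b%:F.
Proof.
by exists \n_(repr x), \d_(repr x); split; [exact: denom_ratioP|exact: fracE].
Qed.

Lemma map_mpoly_inj n (R S : nzRingType) (f : {rmorphism R -> S}) :
  injective f -> injective (@map_mpoly n R S f).
Proof.
move=> f_inj p q /mpolyP pq; apply/mpolyP => m; apply: f_inj.
by rewrite -!mcoeff_map_mpoly pq.
Qed.

Lemma frac_mpoly_map n (F : fieldType) (R : idomainType)
    (f : {rmorphism R -> F}) : injective f ->
  exists phi : {rmorphism {fraction {mpoly R[n]}} -> {fraction {mpoly F[n]}}},
    forall p, phi p%:F = (map_mpoly f p)%:F.
Proof.
move=> f_inj; apply: (@frac_lift _ _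
  (@FracField.tofrac {mpoly F[n]} \o @map_mpoly n R F f)).
by move=> p q /eqP; rewrite /= tofrac_eq => /eqP/(map_mpoly_inj f_inj).
Qed.

Section Variables.

Variables (n : nat) (F : fieldType).

Definition frac_const (c : F) : {fraction {mpoly F[n]}} := (c%:MP_[n])%:F.
HB.instance Definition _ := GRing.RMorphism.copy frac_const
  (@FracField.tofrac {mpoly F[n]} \o @mpolyC n F).

Definition frac_var (i : 'I_n) : {fraction {mpoly F[n]}} := ('X_i)%:F.

Lemma mmap_frac_var (P : {mpoly F[n]}) : mmap frac_const frac_var P = P%:F.
Proof.
elim/mpolyind: P => [|c m P _ _ IHP]; first by rewrite mmap0 tofrac0.
rewrite mmapD tofracD IHP mmapZ mmapX -mul_mpolyC tofracM; congr (_ * _ + _).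
rewrite mpolyXE_id rmorph_prod /=; apply: eq_bigr => i _.
by rewrite tofracXn.
Qed.

Lemma frac_var_free : relation_free frac_const frac_var.
Proof. by move=> P; rewrite mmap_frac_var => /eqP; rewrite tofrac_eq0 => /eqP. Qed.

Lemma gen_frac_var (S : _ -> Prop) z : (forall c, gen S (frac_const c)) ->
  (forall i, gen S (frac_var i)) -> gen S z.
Proof.
move=> gc gv; have [a [b [_ ->]]] := frac_ind z.
have gF P : gen S P%:F.
  rewrite -mmap_frac_var /mmap; apply: gen_sum => m _; apply: genM => //.
  by apply: gen_prod => i _; apply: genX.
exact: gen_div.
Qed.

End Variables.

Lemma mmap_comp n (k K E : fieldType) (iota : {rmorphism k -> K})
    (phi : {rmorphism K -> E}) (y : 'I_n -> K) P :
  mmap (phi \o iota) (phi \o y) P = phi (mmap iota y P).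
Proof.
rewrite /mmap rmorph_sum; apply: eq_bigr => m _; rewrite rmorphM /=.
congr (_ * _); rewrite /mmap1 rmorph_prod; apply: eq_bigr => i _.
by rewrite rmorphXn.
Qed.

Lemma relation_free_comp n (k K E : fieldType) (iota : {rmorphism k -> K})
    (phi : {rmorphism K -> E}) (y : 'I_n -> K) :
  relation_free iota y <-> relation_free (phi \o iota) (phi \o y).
Proof.
split=> h P; first by rewrite mmap_comp => /eqP; rewrite fmorph_eq0 => /eqP/h.
by move=> P0; apply: h; rewrite mmap_comp P0 rmorph0.
Qed.

(** Additivity along a tower: independence over the larger field generated by [T] persists over
    S(xs). *)
Lemma alg_indep_cat (E : fieldType) (S T : E -> Prop) xs ys :
  alg_indep S xs -> (forall z, adjoins S xs z -> gen T z) ->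
  alg_indep T ys -> alg_indep S (xs ++ ys).
Proof.
elim/last_ind: ys => [|ys y IHys] ixs h; first by rewrite cats0.
move=> /alg_indep_rcons[iys ny]; rewrite -rcons_cat; apply/alg_indep_rcons.
split; first exact: IHys.
apply: contra_not ny; apply: algebraic_in_trans => z zS.
apply: algebraic_in_gen.
have gT w : adjoins S xs w \/ w \in ys -> gen (adjoins T ys) w.
  case=> [/h|wys]; first by apply: gen_mono => u; left.
  by apply: gen_in; right.
apply: gT; case: zS => [Sz|]; first by left; left.
by rewrite mem_cat => /orP[]; [left; right|right].
Qed.

(** * Galois descent along F(X) = Y X *)

Lemma power_rmorphism (E : fieldType) q : [pchar E].-nat q ->
  exists phi : {rmorphism E -> E}, forall x, phi x = x ^+ q.
Proof.
move=> pq; pose phi (x : E) := x ^+ q.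
have phiB : zmod_morphism phi by move=> x y; rewrite /phi exprDn_pchar ?exprNn_pchar.
have phiM : monoid_morphism phi.
  by split=> [|x y]; rewrite /phi ?expr1n ?exprMn.
pose phiP : {rmorphism E -> E} := HB.pack phi
  (GRing.isZmodMorphism.Build _ _ phi phiB)
  (GRing.isMonoidMorphism.Build _ _ phi phiM).
by exists phiP.
Qed.

Lemma card_pchar_nat (F : finFieldType) (E : fieldType)
  (eps : {rmorphism F -> E}) : [pchar E].-nat #|F|.
Proof.
have [p pr_p pF] := finPcharP F.
have pE : p \in [pchar E] by rewrite (fmorph_pchar eps).
by rewrite (card_pprimeChar pF) pnatX pnatE // pE.
Qed.

(** Lagrange interpolation: a product of factors (a - a u) / (a t0 - a u), with [a] separating u
    from t0. It serves both for the matrices C and for group elements, where it amounts to the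
    independence of automorphisms. *)
Lemma sep_indicator (T : finType) (E : fieldType) (P A : (T -> E) -> Prop)
    (D : T -> Prop) (t0 : T) :
  (forall f g, f =1 g -> P f -> P g) -> P (fun=> 1) ->
  (forall f g, P f -> P g -> P (fun t => f t + g t)) ->
  (forall c f, P f -> P (fun t => c * f t)) ->
  (forall a f, A a -> P f -> P (fun t => f t * a t)) ->
  (forall t, D t -> t != t0 -> exists a, A a /\ a t != a t0) ->
  exists f, [/\ P f, f t0 = 1 & forall t, D t -> t != t0 -> f t = 0].
Proof.
move=> Pext P1 PD PZ PA sep.
suff [f [Pf f1 f0]] : exists f, [/\ P f, f t0 = 1 &
    forall t, t \in enum T -> D t -> t != t0 -> f t = 0].
  by exists f; split=> // t; apply: f0; rewrite mem_enum.
elim: (enum T) => [|u r [f [Pf f1 f0]]]; first by exists (fun=> 1).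
have [->|nu] := eqVneq u t0.
  exists f; split=> // t; rewrite inE => /predU1P[->|tr] Dt nt; last exact: f0.
  by rewrite eqxx in nt.
case: (excluded_middle_informative (D u)) => [Du|nDu]; last first.
  by exists f; split=> // t; rewrite inE => /predU1P[->|tr] Dt nt //; apply: f0.
have [a [Aa nau]] := sep u Du nu.
have d0 : a t0 - a u != 0 by rewrite subr_eq0 eq_sym.
exists (fun t => f t * (a t - a u) / (a t0 - a u)); split.
- have := PD _ _ (PZ (a t0 - a u)^-1 _ (PA _ _ Aa Pf))
    (PZ (- (a u / (a t0 - a u))) _ Pf).
  by apply: Pext => t; field.
- by rewrite f1 mul1r divff.
- move=> t; rewrite inE => /predU1P[->|tr] Dt nt; first by rewrite subrr mulr0 mul0r.
  by rewrite f0 // !mul0r.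
Qed.

Section Correspondence.

Variables (E : fieldType) (F : finFieldType) (eps : {rmorphism F -> E}) (n : nat).
Variable X : 'M[E]_n.
Implicit Types (S : E -> Prop) (C : 'M[F]_n) (h : 'M[F]_n -> E).

Local Notation coord C := (X *m map_mx eps C).

(* The functions C |-> P(X C) where P is a polynomial over the subfield        *)
(* generated by S.                                                             *)
Inductive corr S : ('M[F]_n -> E) -> Prop :=
| corr_const c of gen S c : corr S (fun=> c)
| corr_coord i j : corr S (fun C => coord C i j)
| corrD h h' of corr S h & corr S h' : corr S (fun C => h C + h' C)
| corrM h h' of corr S h & corr S h' : corr S (fun C => h C * h' C)
| corr_ext h h' of h =1 h' & corr S h : corr S h'.

(* X C is a specialization of X over the subfield generated by S.              *)
Definition special S C := forall h, corr S h -> h 1%:M = 0 -> h C = 0.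

Lemma corr_trans S A h : (forall z, S z -> gen A z) -> corr S h -> corr A h.
Proof.
move=> SA; elim=> [c gc|i j|h1 h2 _ c1 _ c2|h1 h2 _ c1 _ c2|h1 h2 eh _ c1].
- exact: corr_const (gen_trans SA gc).
- exact: corr_coord.
- exact: corrD.
- exact: corrM.
- exact: corr_ext eh c1.
Qed.

Lemma special_trans S A C :
  (forall z, S z -> gen A z) -> special A C -> special S C.
Proof. by move=> SA spC h /(corr_trans SA); apply: spC. Qed.

Definition entries m p (B : 'M[E]_(m, p)) : E -> Prop :=
  fun z => exists i j, z = B i j.

Lemma coord1 : coord 1%:M = X.
Proof. by rewrite map_scalar_mx rmorph1 mulmx1. Qed.

Lemma gen_corr S z : gen (fun w => S w \/ entries X w) z ->
  exists h h', [/\ corr S h, corr S h', h' 1%:M != 0 & z = h 1%:M / h' 1%:M].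
Proof.
have c1 : corr S (fun=> 1) by apply: corr_const; apply: gen1.
elim=> [y Sy||a b _ [p [q [cp cq q0 ->]]] _ [p' [q' [cp' cq' q'0 ->]]]
       |a b _ [p [q [cp cq q0 ->]]] _ [p' [q' [cp' cq' q'0 ->]]]].
- case: Sy => [Sy|[i [j ->]]].
    exists (fun=> y), (fun=> 1); rewrite oner_neq0 divr1; split=> //.
    by apply: corr_const; apply: gen_in.
  exists (fun C => coord C i j), (fun=> 1); rewrite oner_neq0 divr1 coord1.
  by split=> //; apply: corr_coord.
- by exists (fun=> 1), (fun=> 1); rewrite oner_neq0 divr1.
- exists (fun C => p C * q' C + (-1) * (p' C * q C)), (fun C => q C * q' C).
  split; [|exact: corrM|exact: mulf_neq0|by field; apply/andP].
  apply: corrD; [exact: corrM|apply: corrM; last exact: corrM].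
  by apply: corr_const; apply/genN/gen1.
- have [p'0|p'0] := eqVneq (p' 1%:M) 0.
    exists (fun=> 0), (fun=> 1); rewrite p'0 oner_neq0 !mul0r invr0 mulr0.
    by split=> //; apply: corr_const; apply: gen0.
  exists (fun C => p C * q' C), (fun C => q C * p' C).
  by split; [exact: corrM|exact: corrM|exact: mulf_neq0|field; apply/and3P].
Qed.

Section Basis.

Variables (S : E -> Prop) (Y : 'M[E]_n).
Hypotheses (X_unit : X \in unitmx) (Y_gen : forall i j, gen S (Y i j)).
Hypothesis XY : map_mx (fun x => x ^+ #|F|) X = Y *m X.

(** The entries of C lie in [F], where the power map is the identity, so X C solves the same
    equation F(X) = Y X. *)
Lemma coord_power C i j : coord C i j ^+ #|F| = \sum_l Y i l * coord C l j.
Proof.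
have [phi phiE] := power_rmorphism (card_pchar_nat eps).
transitivity ((Y *m coord C) i j); last by rewrite mxE.
rewrite mulmxA -XY -phiE; transitivity ((map_mx phi (coord C)) i j).
  by rewrite [RHS]mxE.
rewrite map_mxM; congr ((_ *m _) i j); apply/matrixP => a b; rewrite !mxE ?phiE //.
by rewrite -rmorphXn expf_card.
Qed.

Definition monomial (m : 'I_n -> 'I_n -> nat) C :=
  \prod_i \prod_j coord C i j ^+ m i j.

(** Exponents below the order of [F], coded by a matrix over [F] through [enum_rank]. There are thus
    as many reduced monomials as points C. *)
Definition reduced (A : 'M[F]_n) : 'M[F]_n -> E :=
  monomial (fun i j => enum_rank (A i j)).

Definition in_span h := exists2 c : 'M[F]_n -> E,
  (forall A, gen S (c A)) & forall C, h C = \sum_A c A * reduced A C.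

Lemma in_span_ext h h' : h =1 h' -> in_span h -> in_span h'.
Proof. by move=> eh [c gc hE]; exists c => // C; rewrite -eh. Qed.

Lemma in_spanZ c h : gen S c -> in_span h -> in_span (fun C => c * h C).
Proof.
move=> gc [d gd hE]; exists (fun A => c * d A) => [A|C]; first exact: genM.
by rewrite hE mulr_sumr; apply: eq_bigr => A _; rewrite mulrA.
Qed.

Lemma in_spanD h h' : in_span h -> in_span h' -> in_span (fun C => h C + h' C).
Proof.
move=> [c gc hE] [c' gc' hE']; exists (fun A => c A + c' A) => [A|C].
  exact: genD.
by rewrite hE hE' -big_split; apply: eq_bigr => A _; rewrite mulrDl.
Qed.

Lemma in_span_sum (I : Type) (r : seq I) (h : I -> 'M[F]_n -> E) :
  (forall i, in_span (h i)) -> in_span (fun C => \sum_(i <- r) h i C).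
Proof.
move=> sh; elim: r => [|i r IHr].
  exists (fun=> 0) => [A|C]; first exact: gen0.
  by rewrite big_nil big1 // => A _; rewrite mul0r.
by apply: in_span_ext (in_spanD (sh i) IHr) => C; rewrite big_cons.
Qed.

Lemma monomialD m m' C :
  monomial (fun i j => m i j + m' i j)%N C = monomial m C * monomial m' C.
Proof.
rewrite -big_split; apply: eq_bigr => i _; rewrite -big_split.
by apply: eq_bigr => j _; rewrite exprD.
Qed.

Lemma monomial_delta i j e C :
  monomial (fun a b => (a == i) && (b == j) * e)%N C = coord C i j ^+ e.
Proof.
rewrite /monomial (bigD1 i) //= [X in _ * X]big1 => [|a ai]; last first.
  by rewrite big1 // => b _; rewrite (negPf ai).
rewrite mulr1 (bigD1 j) //= [X in _ * X]big1 ?mulr1 => [|b bj]; last first.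
  by rewrite (negPf bj) andbF.
by rewrite !eqxx mul1n.
Qed.

Lemma eq_monomial m m' C :
  (forall i j, m i j = m' i j) -> monomial m C = monomial m' C.
Proof. by move=> em; apply: eq_bigr => i _; apply: eq_bigr => j _; rewrite em. Qed.

(** By [coord_power], a coordinate to the power #|F| is traded for a linear form in the coordinates,
    which lowers the degree. *)
Lemma in_span_monomial m : in_span (monomial m).
Proof.
have [N] := ubnP (\sum_i \sum_j m i j); elim: N m => // N IHN m.
rewrite ltnS => degm.
case: (boolP [forall i, forall j, m i j < #|F|]%N) => [/forallP small|].
  have ltm i j : (m i j < #|F|)%N by move/forallP: (small i).
  pose A := \matrix_(i, j) enum_val (Ordinal (ltm i j)).
  exists (fun B => (B == A)%:R) => [B|C].
    by case: eqP => _; [exact: gen1|exact: gen0].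
  rewrite (bigD1 A) //= eqxx mul1r big1 ?addr0 => [|B /negPf->]; last first.
    by rewrite mul0r.
  by apply: eq_monomial => i j; rewrite mxE enum_valK.
rewrite negb_forall => /existsP[i]; rewrite negb_forall => /existsP[j].
rewrite -leqNgt => big_ij.
pose m' a b := (m a b - (a == i) && (b == j) * #|F|)%N.
have mE a b : m a b = (m' a b + (a == i) && (b == j) * #|F|)%N.
  rewrite /m' subnK //; case: eqP => [->|_] //; case: eqP => [->|_] //.
  by rewrite mul1n.
have degD (u v : 'I_n -> 'I_n -> nat) : (\sum_a \sum_b (u a b + v a b))%N =
    (\sum_a \sum_b u a b + \sum_a \sum_b v a b)%N.
  by rewrite -big_split; apply: eq_bigr => a _; rewrite -big_split.
have deg_delta l e : (\sum_a \sum_b (a == l) && (b == j) * e)%N = e.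
  rewrite (bigD1 l) //= [X in (_ + X)%N]big1 => [|a al]; last first.
    by rewrite big1 // => b _; rewrite (negPf al).
  rewrite addn0 (bigD1 j) //= [X in (_ + X)%N]big1 => [|b bj]; last first.
    by rewrite (negPf bj) andbF.
  by rewrite !eqxx mul1n addn0.
have F1 : (1 < #|F|)%N by apply: finNzRing_gt1.
have ltm' l : (\sum_a \sum_b (m' a b + (a == l) && (b == j) * 1) < N)%N.
  apply: leq_trans degm; rewrite (eq_bigr _ (fun a _ => eq_bigr _ (fun b _ => mE a b))).
  by rewrite !degD !deg_delta ltn_add2l.
apply: (@in_span_ext (fun C => \sum_l Y i l *
    monomial (fun a b => m' a b + (a == l) && (b == j) * 1)%N C)).
  move=> C; rewrite (eq_monomial C mE) monomialD monomial_delta coord_power mulr_sumr.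
  by apply: eq_bigr => l _; rewrite monomialD monomial_delta expr1 mulrCA.
by apply: in_span_sum => l; apply: in_spanZ => //; apply/IHN/ltm'.
Qed.

Lemma in_spanM h m : in_span h -> in_span (fun C => h C * monomial m C).
Proof.
move=> [c gc hE]; apply: (@in_span_ext (fun C => \sum_A c A *
    monomial (fun i j => enum_rank (A i j) + m i j)%N C)).
  move=> C; rewrite hE mulr_suml; apply: eq_bigr => A _.
  by rewrite monomialD mulrA.
by apply: in_span_sum => A; apply: in_spanZ => //; apply: in_span_monomial.
Qed.

Lemma corr_span h : corr S h -> in_span h.
Proof.
have span1 : in_span (fun=> 1).
  apply: in_span_ext (in_span_monomial (fun _ _ => 0%N)) => C.
  by rewrite /monomial big1 // => i _; rewrite big1.
elim=> [c gc|i j|h1 h2 _ s1 _ s2|h1 h2 _ s1 _ [d gd d2]|h1 h2 eh _ s1].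
- by apply: in_span_ext (in_spanZ gc span1) => C; rewrite mulr1.
- apply: in_span_ext (in_span_monomial (fun a b => (a == i) && (b == j) * 1)%N) => C.
  by rewrite monomial_delta.
- exact: in_spanD.
- apply: (@in_span_ext (fun C => \sum_A d A * (h1 C * reduced A C))).
    by move=> C; rewrite d2 mulr_sumr; apply: eq_bigr => A _; rewrite mulrCA.
  by apply: in_span_sum => A; apply: in_spanZ => //; apply: in_spanM.
- exact: in_span_ext eh s1.
Qed.


End Basis.

Lemma coord_inj C C' : X \in unitmx -> coord C = coord C' -> C = C'.
Proof. by move=> uX /(can_inj (mulKmx uX))/map_mx_inj. Qed.

(** As X is invertible, the coordinates separate the points C, so by interpolation the reduced
    monomials span all E-valued functions; being as many as the points, they form a basis. *)
Lemma reduced_indicator (Y : 'M[E]_n) C0 : X \in unitmx ->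
  map_mx (fun x => x ^+ #|F|) X = Y *m X ->
  exists c : 'M[F]_n -> E,
    forall C, \sum_A c A * reduced A C = (C == C0)%:R.
Proof.
move=> uX XY; pose T : E -> Prop := fun=> True.
have gT z : gen T z by apply: gen_in.
have spanT h : corr T h -> in_span T h by apply: (corr_span _ XY) => // i j.
have [|||c f|a f [i [j ->]] [c _ fE]|C _ nC|f [[c _ fE] f1 f0]] :=
    @sep_indicator _ _ (in_span T) (fun a => exists i j, a = (fun C => coord C i j))
      (fun=> True) C0.
- exact: in_span_ext.
- by apply: spanT; apply: corr_const.
- exact: in_spanD.
- by apply: in_spanZ; apply: gT.
- apply: (@in_span_ext T (fun C => f C *
      monomial (fun a b => (a == i) && (b == j) * 1)%N C)).
    by move=> C; rewrite monomial_delta expr1.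
  by apply: (in_spanM _ XY) => [i' j'|]; [apply: gT|exists c].
- have /existsP[i /existsP[j ij]] : [exists i, exists j, coord C i j != coord C0 i j].
    apply: contraNT nC; rewrite negb_exists => /forallP h; apply/eqP.
    apply: (coord_inj uX); apply/matrixP => i j; apply/eqP.
    by have := h i; rewrite negb_exists => /forallP/(_ j); rewrite negbK.
  by exists (fun C => coord C i j); split=> //; exists i, j.
exists c => C; rewrite -fE; have [->|nC] := eqVneq C C0; first by rewrite f1.
by rewrite f0.
Qed.

(* h - f h' vanishes on special points, so it is an E-combination of functions *)
(* that vanish at 1 and have coordinates in the subfield generated by S, and   *)
(* hence f solves a linear equation over that subfield.                        *)
Lemma corr_descent S (Y : 'M[E]_n) f h h' : X \in unitmx ->
  (forall i j, gen S (Y i j)) -> map_mx (fun x => x ^+ #|F|) X = Y *m X ->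
  corr S h -> corr S h' -> h' 1%:M != 0 ->
  (forall C, special S C -> h C = f * h' C) -> gen S f.
Proof.
move=> uX gY XY ch ch' h'1 hf; have [M [iota genE]] := gen_field S.
pose N := #|{: 'M[F]_n}|.
have span g : in_span S g -> exists u : 'rV[M]_N,
    forall C, g C = \sum_A iota (u 0 (enum_rank A)) * reduced A C.
  move=> [c gc gE].
  have /fin_all_exists[u uE] A : exists a, iota a = c A by apply/genE.
  exists (\row_i u (enum_val i)) => C.
  by rewrite gE; apply: eq_bigr => A _; rewrite mxE enum_rankK uE.
have [p pE] := span h (corr_span gY XY ch).
have [q qE] := span h' (corr_span gY XY ch').
have /fin_all_exists[c cE] C0 := reduced_indicator C0 uX XY.
have /fin_all_exists[I IE] C : exists g, [/\ corr S g, g 1%:M = 0 &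
    (special S C \/ g C != 0)].
  case: (excluded_middle_informative (special S C)) => [sC|nsC].
    by exists (fun=> 0); split=> //; [apply: corr_const; apply: gen0|left].
  have [g [cg g1 gC]] : exists g, [/\ corr S g, g 1%:M = 0 & g C <> 0].
    apply: NNPP => ng; apply: nsC => g cg g1; apply: NNPP => gC.
    by apply: ng; exists g.
  by exists g; split=> //; right; apply/eqP.
have /fin_all_exists[u uE] (CA : 'M[F]_n * 'M[F]_n) : exists u : 'rV[M]_N,
    forall C, I CA.1 C * reduced CA.2 C =
    \sum_A iota (u 0 (enum_rank A)) * reduced A C.
  have [cI _ _] := IE CA.1; apply: span.
  by apply: (in_spanM gY XY); apply: (corr_span gY XY).
pose U : 'M[M]_(#|{: 'M[F]_n * 'M[F]_n}|, N) := \matrix_(r, j) u (enum_val r) 0 j.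
(* [B] holds the values of the reduced monomials at all points; its invertibility makes coordinates
   unique. *)
pose B : 'M[E]_N := \matrix_(i, j) reduced (enum_val i) (enum_val j).
have BE (v : 'rV[E]_N) j :
    (v *m B) 0 j = \sum_A v 0 (enum_rank A) * reduced A (enum_val j).
  rewrite mxE (reindex (@enum_rank _)) /=; last by apply: onW_bij; apply: enum_rank_bij.
  by apply: eq_bigr => A _; rewrite mxE enum_rankK.
have uB : B \in unitmx.
  pose K : 'M[E]_N := \matrix_(i, j) c (enum_val i) (enum_val j).
  suff /mulmx1_unit[] : K *m B = 1%:M by [].
  apply/row_matrixP => i; rewrite row_mul; apply/rowP => j; rewrite BE.
  rewrite !mxE -(inj_eq enum_val_inj) eq_sym -cE; apply: eq_bigr => A _.
  by rewrite !mxE enum_rankK.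
(* The weight at the pair (C, A) expands the indicator of C, times [I C], scaled so as to give h - f
   h' at C. At a special C that value is already zero. *)
have HU : (map_mx iota p - f *: map_mx iota q <= map_mx iota U)%MS.
  pose w : 'rV[E]_#|{: 'M[F]_n * 'M[F]_n}| := \row_r
    let: (C, A) := enum_val r in (h C - f * h' C) / I C C * c C A.
  suff -> : map_mx iota p - f *: map_mx iota q = w *m map_mx iota U.
    exact: submxMl.
  apply: (can_inj (mulmxK uB)); apply/rowP => j.
  have -> : ((map_mx iota p - f *: map_mx iota q) *m B) 0 j =
      h (enum_val j) - f * h' (enum_val j).
    rewrite BE pE qE mulr_sumr -sumrB; apply: eq_bigr => A _.
    by rewrite !mxE mulrBl mulrA.
  set C0 := enum_val j.
  transitivity (\sum_CA (h CA.1 - f * h' CA.1) / I CA.1 CA.1 * c CA.1 CA.2 *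
      (I CA.1 C0 * reduced CA.2 C0)).
    rewrite -(pair_bigA _ (fun C A => (h C - f * h' C) / I C C * c C A *
      (I C C0 * reduced A C0))) /=.
    rewrite (bigD1 C0) //= [X in _ = _ + X]big1 => [|C nC].
      rewrite addr0; transitivity ((h C0 - f * h' C0) / I C0 C0 * I C0 C0 *
          \sum_A c C0 A * reduced A C0).
        rewrite cE eqxx mulr1; have [_ _ [sC0|nI]] := IE C0.
          by rewrite hf // subrr !mul0r.
        by rewrite divfK.
      by rewrite mulr_sumr; apply: eq_bigr => A _; ring.
    transitivity ((h C - f * h' C) / I C C * I C C0 *
        \sum_A c C A * reduced A C0); last by rewrite cE eq_sym (negPf nC) mulr0.
    by rewrite mulr_sumr; apply: eq_bigr => A _; ring.
  rewrite -mulmxA mxE (reindex (@enum_rank _)) /=; last first.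
    by apply: onW_bij; apply: enum_rank_bij.
  apply: eq_bigr => -[C A] _; rewrite mxE enum_rankK uE /=; congr (_ * _).
  rewrite mxE (reindex (@enum_rank _)) /=; last first.
    by apply: onW_bij; apply: enum_rank_bij.
  by apply: eq_bigr => A' _; rewrite !mxE !enum_rankK.
(* The cokernel of [U] is defined over [M], so this is a linear system for f over [M]. *)
have coker0 : map_mx iota (p *m cokermx U) = f *: map_mx iota (q *m cokermx U).
  apply/eqP; rewrite -subr_eq0 (map_mxM _ p) (map_mxM _ q) scalemxAl -mulmxBl map_cokermx.
  by move: HU; rewrite submxE.
(* If all coefficients of f were zero, h' would be a combination of functions vanishing at 1. *)
case: (boolP (q <= U)%MS) => [/submxP[D qD]|].
  case/eqP: h'1; rewrite qE; transitivity ((map_mx iota q *m B) 0 (enum_rank 1%:M)).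
    by rewrite BE; apply: eq_bigr => A _; rewrite mxE enum_rankK.
  rewrite qD map_mxM -mulmxA mxE big1 // => r _.
  suff -> : (map_mx iota U *m B) r (enum_rank 1%:M) = 0 by rewrite mulr0.
  transitivity ((row r (map_mx iota U) *m B) 0 (enum_rank 1%:M)).
    by rewrite -row_mul [RHS]mxE.
  rewrite BE enum_rankK; case rE: (enum_val r) => [C A].
  transitivity (I C 1%:M * reduced A 1%:M).
    by rewrite (uE (C, A)); apply: eq_bigr => A' _; rewrite !mxE rE.
  by have [_ -> _] := IE C; rewrite mul0r.
rewrite submxE => /rV0Pn[j nj]; apply/genE.
exists ((p *m cokermx U) 0 j / (q *m cokermx U) 0 j).
have := congr1 (fun v : 'rV[E]_N => v 0 j) coker0.
rewrite [LHS]mxE [RHS]mxE [map_mx _ _ _ _ in RHS]mxE => e.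
by rewrite rmorphM fmorphV e mulfK // fmorph_eq0.
Qed.

End Correspondence.

(** Iterating the equation gives F^r(X) = Z_r X. The i-th rows of Z_0, ..., Z_n are n + 1 vectors of
    length n; a linear dependence between them is a nonzero polynomial in the powers x^(q^r) that
    kills the entries of row i of X. *)
Lemma power_matrix_algebraic (E : fieldType) q n (S : E -> Prop) (X Y : 'M[E]_n) i j :
  (1 < q)%N -> [pchar E].-nat q -> (forall a b, gen S (Y a b)) ->
  map_mx (fun x => x ^+ q) X = Y *m X -> algebraic_in S (X i j).
Proof.
move=> q1 pq gY XY; have [M [iota genE]] := gen_field S.
have [phi phiE] := power_rmorphism pq.
have iter_q r : exists Z : 'M[E]_n, (forall a b, gen S (Z a b)) /\
    map_mx (fun x => x ^+ (q ^ r)) X = Z *m X.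
  elim: r => [|r [Z [gZ ZX]]].
    exists 1%:M; split=> [a b|]; first by rewrite mxE; case: eqP => _; [exact: gen1|exact: gen0].
    by rewrite mul1mx; apply/matrixP => a b; rewrite mxE expr1.
  exists (map_mx phi Z *m Y); split=> [a b|].
    rewrite mxE; apply: gen_sum => l _; apply: genM => //.
    by rewrite mxE phiE; apply: genX.
  rewrite -mulmxA -XY; transitivity (map_mx phi (Z *m X)).
    by rewrite -ZX; apply/matrixP => a b; rewrite !mxE phiE -exprM -expnSr.
  by rewrite map_mxM; congr (_ *m _); apply/matrixP => a b; rewrite !mxE phiE.
have /fin_all_exists[Z ZE] (r : 'I_n.+1) := iter_q r.
have /fin_all_exists[w wE] (rl : 'I_n.+1 * 'I_n) : exists a, iota a = Z rl.1 i rl.2.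
  by apply/genE; apply: (ZE rl.1).1.
pose W := \matrix_(r, l) w (r, l).
have /rowV0Pn[c /sub_kermxP cW c0] : kermx W != 0.
  by rewrite kermx_eq0 /row_free neq_ltn ltnS rank_leq_col.
have /rV0Pn[r0 cr0] := c0.
exists (\sum_r iota (c 0 r) *: 'X^(q ^ (r : 'I_n.+1))).
  apply: contraNneq cr0 => /polyP/(_ (q ^ r0)%N).
  rewrite coef0 coef_sum (bigD1 r0) //= coefZ coefXn eqxx mulr1 big1 ?addr0.
    by move/eqP; rewrite fmorph_eq0.
  by move=> r nr; rewrite coefZ coefXn eqn_exp2l // eq_sym val_eqE (negPf nr) mulr0.
split=> [|l]; last first.
  rewrite coef_sum; apply: gen_sum => r _; rewrite coefZ; apply: genM.
    by apply/genE; eexists.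
  by rewrite coefXn; case: eqP => _; [exact: gen1|exact: gen0].
apply/rootP; rewrite horner_sum.
transitivity (\sum_r \sum_l iota (c 0 r * W r l) * X l j).
  apply: eq_bigr => r _; rewrite hornerZ hornerXn.
  have := congr1 (fun A : 'M[E]_n => A i j) (ZE r).2; rewrite !mxE => ->.
  rewrite mulr_sumr; apply: eq_bigr => l _.
  by rewrite mxE rmorphM wE mulrA.
rewrite exchange_big big1 // => l _; rewrite -mulr_suml -rmorph_sum.
have := congr1 (fun v : 'rV[M]_n => v 0 l) cW; rewrite !mxE => ->.
by rewrite rmorph0 mul0r.
Qed.

(** With f = h(1) / h'(1), the endomorphism alpha carries P(X) to P(X C), so h = f h' propagates
    from 1 to every special C and [corr_descent] applies. *)
Lemma lang_descent (E : fieldType) (F : finFieldType) (eps : {rmorphism F -> E}) n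
    (S : E -> Prop) (X Y : 'M[E]_n) f :
  X \in unitmx -> (forall i j, gen S (Y i j)) ->
  map_mx (fun x => x ^+ #|F|) X = Y *m X ->
  (forall C, special eps X S C -> exists alpha : {rmorphism E -> E},
    [/\ forall z, S z -> alpha z = z, map_mx alpha X = X *m map_mx eps C
      & alpha f = f]) ->
  gen (fun z => S z \/ entries X z) f -> gen S f.
Proof.
move=> uX gY XY inv /(gen_corr eps)[h [h' [ch ch' h'1 fE]]].
apply: (corr_descent uX gY XY ch ch' h'1) => C /inv[alpha [aS aX af]].
have agen z : gen S z -> alpha z = z.
  elim=> [y /aS//||a b _ ea _ eb|a b _ ea _ eb]; first exact: rmorph1.
    by rewrite rmorphB ea eb.
  by rewrite rmorphM fmorphV ea eb.
have acorr g : corr eps X S g -> alpha (g 1%:M) = g C.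
  elim=> [c /agen//|i j|g1 g2 _ e1 _ e2|g1 g2 _ e1 _ e2|g1 g2 eg _ e1].
  - by rewrite coord1 -aX mxE.
  - by rewrite rmorphD e1 e2.
  - by rewrite rmorphM e1 e2.
  - by rewrite -!eg.
have : h 1%:M = f * h' 1%:M by rewrite fE divfK.
by move/(congr1 alpha); rewrite rmorphM af !acorr.
Qed.

(** Each average V_i, the sum over g of g(c_i) rho(g^-1), satisfies the equation required of B.
    Since G acts faithfully on S, [sep_indicator] yields c_i in the subfield and w_i in E such that
    the sum of the w_i g(c_i) is 1 for g = 1 and 0 otherwise. The w_i-combination of the V_i is then
    the identity, so their rows span, and n independent rows form B; the equation holds row by
    row. *)
Lemma speiser (E k : fieldType) (iota : {rmorphism k -> E}) (gT : finGroupType)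
    (G : {group gT}) (alpha : gT -> {rmorphism E -> E}) (S : E -> Prop) n
    (rho : mx_representation k G n) :
  (forall g h z, g \in G -> h \in G -> alpha g (alpha h z) = alpha (g * h)%g z) ->
  (forall g c, g \in G -> alpha g (iota c) = iota c) ->
  (forall g, g \in G -> (forall z, S z -> alpha g z = z) -> g = 1%g) ->
  (forall c, gen S (iota c)) ->
  (forall g z, g \in G -> S z -> gen S (alpha g z)) ->
  exists B : 'M[E]_n, [/\ B \in unitmx,
    forall g, g \in G -> map_mx (alpha g) B = B *m map_mx iota (rho g)
    & forall i j, gen S (B i j)].
Proof.
move=> aM ac sep gk aS.
pose P (f : gT -> E) := exists l (w c : 'I_l -> E), (forall i, gen S (c i)) /\
  forall g, g \in G -> f g = \sum_i w i * alpha g (c i).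
have agen g z : g \in G -> gen S z -> gen S (alpha g z).
  move=> Gg; elim=> [y /(aS g _ Gg)//||a b _ ga _ gb|a b _ ga _ gb].
  - by rewrite rmorph1; apply: gen1.
  - by rewrite rmorphB; apply: genB.
  - by rewrite rmorphM fmorphV; apply: gen_div.
have a1 z : alpha 1%g z = z.
  apply: (fmorph_inj (alpha 1%g)); by rewrite aM // mulg1.
have [||f g [l [w [c [gc fE]]]] [l' [w' [c' [gc' gE]]]]
    |e f [l [w [c [gc fE]]]]|a f [d [gd ->]] [l [w [c [gc fE]]]]
    |g Gg ng|f [[l [w [c [gc fE]]]] f1 f0]] :=
  @sep_indicator _ _ P (fun a => exists c, gen S c /\ a = fun g => alpha g c)
    (fun g => g \in G) 1%g.
- move=> f g fg [l [w [c [gc fE]]]]; exists l, w, c; split=> // h Gh.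
  by rewrite -fg fE.
- exists 1%N, (fun=> 1), (fun=> 1); split=> [_|g _]; first exact: gen1.
  by rewrite big_ord1 rmorph1 mulr1.
- pose glue T (u : 'I_l -> T) (v : 'I_l' -> T) (i : 'I_(l + l')) :=
    match split i with inl j => u j | inr j => v j end.
  exists (l + l')%N, (glue _ w w'), (glue _ c c'); split=> [i|h Gh].
    by rewrite /glue; case: split.
  rewrite fE // gE // big_split_ord /=; congr (_ + _); apply: eq_bigr => i _.
    by rewrite /glue -[lshift _ i]/(unsplit (inl i)) unsplitK.
  by rewrite /glue -[rshift _ i]/(unsplit (inr i)) unsplitK.
- exists l, (fun i => e * w i), c; split=> // g Gg.
  by rewrite fE // mulr_sumr; apply: eq_bigr => i _; rewrite mulrA.
- exists l, w, (fun i => c i * d); split=> [i|g Gg]; first exact: genM.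
  by rewrite fE // mulr_suml; apply: eq_bigr => i _; rewrite rmorphM mulrA.
- apply: NNPP => nsep; case/eqP: ng; apply: sep => // z Sz; apply: NNPP => gz.
  apply: nsep; exists (fun g => alpha g z); split.
    by exists z; split=> //; apply: gen_in.
  by apply/eqP; rewrite a1.
pose V i : 'M[E]_n := \sum_(g in G) alpha g (c i) *: map_mx iota (rho g^-1%g).
have VE i g : g \in G -> map_mx (alpha g) (V i) = V i *m map_mx iota (rho g).
  move=> Gg; rewrite /V mulmx_suml raddf_sum /=.
  rewrite [RHS](reindex_inj (mulgI g)) /=; apply: eq_big => [h|h Gh].
    by rewrite groupMl.
  rewrite map_mxZ aM // -scalemxAl -map_mxM -repr_mxM ?groupV ?groupM //.
  rewrite invMg mulgKV; congr (_ *: _); apply/matrixP => a b.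
  by rewrite !mxE ac.
have sumV : \sum_i w i *: V i = 1%:M.
  under eq_bigr => i _ do rewrite scaler_sumr.
  rewrite exchange_big /= (bigD1 1%g) ?group1 //= [X in _ + X]big1 => [|g].
    rewrite addr0; under eq_bigr => i _ do rewrite scalerA.
    rewrite -scaler_suml -fE ?group1 // f1 invg1 repr_mx1 map_scalar_mx rmorph1.
    by rewrite scale1r.
  case/andP=> Gg ng; under eq_bigr => i _ do rewrite scalerA.
  by rewrite -scaler_suml -fE // f0 // scale0r.
have gV i a b : gen S (V i a b).
  rewrite /V summxE; apply: gen_sum => g Gg; rewrite !mxE; apply: genM => //.
  exact: agen.
pose R : 'M[E]_(#|{: 'I_l * 'I_n}|, n) :=
  \matrix_(r, j) V (enum_val r).1 (enum_val r).2 j.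
have fullR : row_full R.
  rewrite -sub1mx -sumV; apply: summx_sub => i _; apply: scalemx_sub.
  apply/row_subP => a; suff -> : row a (V i) = row (enum_rank (i, a)) R.
    exact: row_sub.
  by apply/rowP => j; rewrite !mxE enum_rankK.
exists (rowsub (fullrankfun fullR) R); split.
- exact: fullrowsub_unit.
- move=> g Gg; apply/row_matrixP => i.
  rewrite row_mul -map_row row_rowsub.
  set r := fullrankfun fullR i.
  have -> : row r R = row (enum_val r).2 (V (enum_val r).1).
    by apply/rowP => j; rewrite !mxE.
  by rewrite -row_mul -VE // map_row.
- by move=> i j; rewrite !mxE.
Qed.

(** * The no-name lemma *)

Section GeneratedMatrices.

Variables (E : fieldType) (S : E -> Prop).

Definition gen_mx m n (A : 'M[E]_(m, n)) := forall i j, gen S (A i j).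

Lemma gen_mulmx m n p (A : 'M[E]_(m, n)) (B : 'M_(n, p)) :
  gen_mx A -> gen_mx B -> gen_mx (A *m B).
Proof. by move=> gA gB i j; rewrite mxE; apply: gen_sum => l _; apply: genM. Qed.

Lemma gen_trmx m n (A : 'M[E]_(m, n)) : gen_mx A -> gen_mx A^T.
Proof. by move=> gA i j; rewrite mxE. Qed.

Lemma gen_lift_mx (M : fieldType) (iota : {rmorphism M -> E}) m n
    (A : 'M[E]_(m, n)) :
  (forall x, gen S x <-> exists a, iota a = x) ->
  gen_mx A -> exists A', map_mx iota A' = A.
Proof.
move=> genE gA.
have /fin_all_exists[a aE] (ij : 'I_m * 'I_n) : exists a, iota a = A ij.1 ij.2.
  exact/genE.
by exists (\matrix_(i, j) a (i, j)); apply/matrixP => i j; rewrite !mxE aE.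
Qed.

Lemma gen_invmx n (A : 'M[E]_n) : gen_mx A -> gen_mx (invmx A).
Proof.
have [M [iota genE]] := gen_field S; move=> /(gen_lift_mx genE)[A' <-] i j.
by rewrite -map_invmx mxE; apply/genE; eexists.
Qed.

Lemma gen_det n (A : 'M[E]_n) : gen_mx A -> gen S (\det A).
Proof.
have [M [iota genE]] := gen_field S; move=> /(gen_lift_mx genE)[A' <-].
by rewrite det_map_mx; apply/genE; eexists.
Qed.

Lemma gen_power_mx q m n (A : 'M[E]_(m, n)) :
  gen_mx A -> gen_mx (map_mx (fun x => x ^+ q) A).
Proof. by move=> gA i j; rewrite mxE; apply: genX. Qed.

End GeneratedMatrices.

(** The determinant of the generic matrix is a nonzero polynomial, as it takes the value 1 at the
    identity. *)
Lemma generic_matrix_unit n (K : fieldType) :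
  vec_mx (\row_i frac_var K (i : 'I_(n * n))) \in unitmx.
Proof.
pose T : 'M[{mpoly K[n * n]}]_n := vec_mx (\row_i 'X_i).
have TE : vec_mx (\row_i frac_var K (i : 'I_(n * n))) =
    map_mx (@FracField.tofrac {mpoly K[n * n]}) T.
  by apply/matrixP => i j; rewrite !mxE.
rewrite TE unitmxE det_map_mx unitfE tofrac_eq0; apply/eqP.
move/(congr1 (meval (fun i => mxvec (1%:M : 'M[K]_n) 0 i))).
rewrite meval0 -det_map_mx.
suff -> : map_mx (meval (fun i => mxvec (1%:M : 'M[K]_n) 0 i)) T = 1%:M.
  by rewrite det1; apply/eqP; apply: oner_neq0.
by apply/matrixP => i j; rewrite !mxE mevalXU mxvecE mxE.
Qed.

Lemma gen_image (P E : fieldType) (j : {rmorphism P -> E}) (S : P -> Prop)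
    (T : E -> Prop) z :
  (forall x, T x -> exists2 y, gen S y & j y = x) -> gen T (j z) -> gen S z.
Proof.
move=> TS; have im x : gen T x -> exists2 y, gen S y & j y = x.
  elim=> [y /TS//||_ _ _ [a ga <-] _ [b gb <-]|_ _ _ [a ga <-] _ [b gb <-]].
  - by exists 1; [exact: gen1|rewrite rmorph1].
  - by exists (a - b); [exact: genB|rewrite rmorphB].
  - by exists (a / b); [exact: gen_div|rewrite rmorphM fmorphV].
by move=> /im[y gy /fmorph_inj<-].
Qed.

(* The denominator is replaced by its norm.                                    *)
Lemma frac_mpoly_fixed (m : nat) (K L : fieldType) (jL : {rmorphism L -> K})
    (gT : finGroupType) (G : {group gT}) (a : gT -> {rmorphism K -> K})
    (j : {rmorphism {fraction {mpoly L[m]}} -> {fraction {mpoly K[m]}}})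
    (A : gT -> {rmorphism {fraction {mpoly K[m]}} -> {fraction {mpoly K[m]}}}) z :
  (forall p, j p%:F = (map_mpoly jL p)%:F) ->
  (forall g p, A g p%:F = (map_mpoly (a g) p)%:F) ->
  (forall g h z, g \in G -> h \in G -> a g (a h z) = a (g * h)%g z) ->
  (forall x, (forall g, g \in G -> a g x = x) -> exists b, jL b = x) ->
  (forall g, g \in G -> A g z = z) -> exists p, j p = z.
Proof.
move=> jE AE aM fixL fixz.
have a1 x : a 1%g x = x by apply: (fmorph_inj (a 1%g)); rewrite aM // mulg1.
have fix_mpoly (q : {mpoly K[m]}) :
    (forall g, g \in G -> map_mpoly (a g) q = q) -> exists p, map_mpoly jL p = q.
  move=> fixq; have coefL (u : 'X_{1..m}) : exists b, jL b = q@_u.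
    by apply: fixL => g Gg; rewrite -mcoeff_map_mpoly fixq.
  rewrite [q]mpolyE; elim: (msupp q) => [|u r [p pE]].
    by exists 0; rewrite big_nil rmorph0.
  have [b bE] := coefL u; exists (b *: 'X_[u] + p).
  by rewrite big_cons rmorphD /= map_mpolyZ map_mpolyX pE -bE.
have [p [q [q0 zE]]] := frac_ind z.
pose N := \prod_(g in G) map_mpoly (a g) q.
have [N' N'E] : exists N', map_mpoly jL N' = N.
  apply: fix_mpoly => g Gg; rewrite /N rmorph_prod /=.
  rewrite [RHS](reindex_inj (mulgI g)) /=; apply: eq_big => [h|h Gh].
    by rewrite groupMl.
  by apply/mpolyP => u; rewrite !mcoeff_map_mpoly; apply: aM.
have qE : map_mpoly (a 1%g) q = q.
  by apply/mpolyP => u; rewrite mcoeff_map_mpoly; apply: a1.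
pose r := p * \prod_(g in G | g != 1%g) map_mpoly (a g) q.
have NE : N = q * \prod_(g in G | g != 1%g) map_mpoly (a g) q.
  by rewrite /N (bigD1 1%g) //= qE.
have N0 : N != 0.
  apply/prodf_neq0 => g Gg; apply: contraNneq q0 => mq0.
  by apply/eqP/(map_mpoly_inj (@fmorph_inj _ _ (a g))); rewrite mq0 rmorph0.
have zN : z * N%:F = r%:F.
  by rewrite zE NE !tofracM mulrA divfK ?tofrac_eq0.
have [r' r'E] : exists r', map_mpoly jL r' = r.
  apply: fix_mpoly => g Gg; apply/eqP; rewrite -tofrac_eq -AE -zN rmorphM fixz //.
  rewrite AE -N'E; apply/eqP; congr (_ * _%:F); rewrite N'E.
  rewrite /N rmorph_prod /= [RHS](reindex_inj (mulgI g)) /=.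
  apply: eq_big => [h|h Gh]; first by rewrite groupMl.
  by apply/mpolyP => u; rewrite !mcoeff_map_mpoly; apply: aM.
exists (r'%:F / N'%:F); rewrite rmorphM fmorphV !jE r'E N'E -zN mulfK //.
by rewrite tofrac_eq0.
Qed.

(* For a generic X, ys generates the field of invariants of G acting on k(X)   *)
(* by X |-> X rho(g); the existence of Y makes X separable algebraic over it.  *)
Definition lang_data (k : fieldType) (gT : finGroupType) (G : {group gT}) n
    (rho : mx_representation k G n) (F : finFieldType)
    (eps : {rmorphism F -> k}) : Prop :=
  forall (E : fieldType) (iota : {rmorphism k -> E}) (X : 'M[E]_n),
  X \in unitmx -> exists (ys : seq E) (Y : 'M[E]_n),
  let S := adjoins (constant iota) ys in
  [/\ (size ys <= n * n)%N,
      forall g (alpha : {rmorphism E -> E}), g \in G ->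
        (forall c, alpha (iota c) = iota c) ->
        map_mx alpha X = X *m map_mx iota (rho g) ->
        forall y, y \in ys -> alpha y = y,
      gen_mx S Y,
      map_mx (fun x => x ^+ #|F|) X = Y *m X
    & forall C : 'M[F]_n, special (iota \o eps) X S C ->
        exists2 g, g \in G & rho g = map_mx eps C].

Lemma relation_free_linear (E k : fieldType) (iota : {rmorphism k -> E}) n
    (y : 'I_n -> E) (c : 'I_n -> k) :
  relation_free iota y -> \sum_i iota (c i) * y i = 0 -> forall i, c i = 0.
Proof.
move=> fy cy i; have /fy : mmap iota y (\sum_j c j *: 'X_j) = 0.
  rewrite raddf_sum -[RHS]cy; apply: eq_bigr => j _.
  by rewrite /= mmapZ mmapX mmap1U.
move/(congr1 (mcoeff U_(i))); rewrite mcoeff0 raddf_sum (bigD1 i) //=.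
rewrite mcoeffZ mcoeffX eqxx mulr1 big1 ?addr0 // => j ji.
rewrite mcoeffZ mcoeffX -[(_ == _)]/(_ == _ :> 'X_{1..n}).
suff /negPf-> : U_(j)%MM != U_(i)%MM by rewrite mulr0.
apply: contra ji => /eqP/mnmP/(_ i); rewrite !mnm1E eqxx.
by case: eqP => // ->.
Qed.

Lemma inj_surj_bijective (P Q : choiceType) (f : P -> Q) :
  injective f -> (forall z, exists x, f x = z) -> bijective f.
Proof.
move=> f_inj f_surj; have ex z : exists x, f x == z.
  by have [x <-] := f_surj z; exists x.
exists (fun z => xchoose (ex z)) => [x|z]; last exact/eqP/(xchooseP (ex z)).
exact/f_inj/eqP/(xchooseP (ex (f x))).
Qed.

Lemma purely_transcendental_of_free (k P : fieldType) (iota : {rmorphism k -> P})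
    (ys : seq P) : relation_free iota (tnth (in_tuple ys)) ->
  (forall z, gen (adjoins (constant iota) ys) z) -> purely_transcendental iota.
Proof.
set y := tnth _ => fy genP.
have mmap_inj : injective (mmap iota y).
  move=> p q /eqP; rewrite -subr_eq0 -mmapB => /eqP/fy/eqP.
  by rewrite subr_eq0 => /eqP.
have [phi phiE] := frac_lift (f := mmap iota y) mmap_inj.
exists (size ys), phi; split=> [|c]; last by rewrite phiE; apply: mmapC.
apply: inj_surj_bijective => [|z]; first exact: fmorph_inj.
have ysE : [seq y i | i <- enum 'I_(size ys)] = ys by rewrite map_tnth_enum.
have [|p [q [q0 ->]]] := @gen_frac _ _ _ (mmap iota y) _ z (genP z).
  by move=> w; rewrite -{1}ysE; apply: adjoin_mmap.
by exists (p%:F / q%:F); rewrite rmorphM fmorphV !phiE.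
Qed.

(** The fields are abstract: [K] stands for k(V), [E] for K(t_ij), and [P], embedded by [j], for the
    fixed field of [E]. *)
Lemma lang_data_transcendental (k K E P : fieldType) (gT : finGroupType)
    (G : {group gT}) n d (rV : mx_representation k G d)
    (rho : mx_representation k G n) (F : finFieldType) (eps : {rmorphism F -> k})
    (iK : {rmorphism k -> K}) (v : 'I_d -> K) (a : gT -> {rmorphism K -> K})
    (phi : {rmorphism K -> E}) (t : 'I_(n * n) -> E) (A : gT -> {rmorphism E -> E})
    (iP : {rmorphism k -> P}) (j : {rmorphism P -> E}) :
  mx_faithful rV -> mx_faithful rho -> lang_data rho eps ->
  relation_free iK v ->
  (forall z, gen (adjoins (constant iK) [seq v i | i <- enum 'I_d]) z) ->
  (forall g c, a g (iK c) = iK c) ->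
  (forall g j, g \in G -> a g (v j) = \sum_i v i * iK (rV g i j)) ->
  (forall g h z, g \in G -> h \in G -> a g (a h z) = a (g * h)%g z) ->
  relation_free phi t ->
  (forall S z, (forall x, gen S (phi x)) -> (forall i, gen S (t i)) -> gen S z) ->
  vec_mx (\row_i t i) \in unitmx ->
  (forall g z, A g (phi z) = phi (a g z)) ->
  (forall g i, A g (t i) = t i) ->
  (forall g h z, g \in G -> h \in G -> A g (A h z) = A (g * h)%g z) ->
  (forall c, j (iP c) = phi (iK c)) ->
  (forall g p, g \in G -> A g (j p) = j p) ->
  (forall z, (forall g, g \in G -> A g z = z) -> exists p, j p = z) ->
  purely_transcendental iP.
Proof.
move=> fV frho data fv genK ac av aM ft gen_t uT Aphi At AM jiP Aj imj.
pose iE : {rmorphism k -> E} := phi \o iK.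
have Ac g c : A g (iE c) = iE c by rewrite /iE /= Aphi ac.
have rV1 g : g \in G -> (forall i, a g (v i) = v i) -> g = 1%g.
  move=> Gg gv; apply: (mx_faithful_inj fV) => //.
  apply/matrixP => i l; rewrite repr_mx1; apply/eqP; rewrite -subr_eq0; apply/eqP.
  apply: (relation_free_linear (c := fun i => rV g i l - (1%:M : 'M_d) i l) fv).
  under eq_bigr => x _ do rewrite rmorphB mulrBl mulrC.
  rewrite sumrB -av // gv (bigD1 l) //= mxE eqxx rmorph1 mul1r big1 ?addr0 ?subrr //.
  by move=> x xl; rewrite mxE (negPf xl) rmorph0 mul0r.
(* Speiser over k(V): the matrix T, whose entries are fixed, is changed into X, on which G acts
   through rho. *)
have [B [uB aB gB]] : exists B : 'M[K]_n, [/\ B \in unitmx,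
    forall g, g \in G -> map_mx (a g) B = B *m map_mx iK (rho g)
    & forall i l, gen (adjoins (constant iK) [seq v i | i <- enum 'I_d]) (B i l)].
  apply: speiser => // g Gg h; apply: rV1 => // i; apply: h; right.
  by apply: map_f; rewrite mem_enum.
pose T : 'M[E]_n := vec_mx (\row_i t i).
pose X := T *m map_mx phi B.
have uX : X \in unitmx by rewrite unitmx_mul uT map_unitmx.
have AX g : g \in G -> map_mx (A g) X = X *m map_mx iE (rho g).
  move=> Gg; rewrite /X map_mxM /= -mulmxA; congr (_ *m _).
    by apply/matrixP => i l; rewrite !mxE At.
  rewrite map_mx_comp -map_mxM -aB //; apply/matrixP => i l.
  by rewrite !mxE Aphi.
have [ys [Y [size_ys ysfix gY XY spec]]] := data E iE X uX.
pose S2 : E -> Prop := fun z => constant iE z \/ entries X z.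
(* Speiser in the other direction, over k(X): dividing V by [B2] makes it invariant. *)
have [B2 [uB2 AB2 gB2]] : exists B : 'M[E]_d, [/\ B \in unitmx,
    forall g, g \in G -> map_mx (A g) B = B *m map_mx iE (rV g)
    & forall i l, gen S2 (B i l)].
  apply: speiser => // [g Gg h|c|g z Gg].
  - apply: (mx_faithful_inj frho) => //; rewrite repr_mx1.
    apply: (map_mx_inj (f := iE)); rewrite map_scalar_mx rmorph1.
    apply: (can_inj (mulKmx uX)); rewrite mulmx1 -AX //.
    by apply/matrixP => i l; rewrite mxE; apply: h; right; exists i, l.
  - by apply: gen_in; left; exists c.
  - case=> [[c <-]|[i [l ->]]]; first by rewrite Ac; apply: gen_in; left; exists c.
    have := congr1 (fun M : 'M[E]_n => M i l) (AX g Gg); rewrite !mxE => ->.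
    apply: gen_sum => x _; apply: genM; apply: gen_in.
      by right; exists i, x; rewrite mxE.
    by left; exists (rho g x l); rewrite mxE.
pose V : 'rV[E]_d := \row_i phi (v i).
have AV g : g \in G -> map_mx (A g) V = V *m map_mx iE (rV g).
  move=> Gg; apply/rowP => i; rewrite !mxE Aphi av // rmorph_sum.
  by apply: eq_bigr => x _; rewrite !mxE rmorphM.
pose V' := V *m invmx B2.
have AV' g : g \in G -> map_mx (A g) V' = V'.
  move=> Gg; rewrite /V' map_mxM map_invmx AV // AB2 //.
  have uBR : B2 *m map_mx iE (rV g) \in unitmx.
    by rewrite unitmx_mul uB2 map_unitmx repr_mx_unit.
  by apply: (can_inj (mulmxK uBR)); rewrite mulmxKV // mulmxA mulmxKV.
pose zs := ys ++ [seq V' 0 i | i <- enum 'I_d].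
pose S := adjoins (constant iE) zs.
have Sys z : adjoins (constant iE) ys z -> S z.
  by case=> [cz|zy]; [left|right; rewrite mem_cat zy].
have gYS : gen_mx S Y by move=> i l; apply: gen_mono (gY i l).
pose SX : E -> Prop := fun z => S z \/ entries X z.
have gX : gen_mx SX X by move=> i l; apply: gen_in; right; exists i, l.
have gphi z : gen SX (phi z).
  have gphiv i : gen SX (phi (v i)).
    suff gV : gen_mx SX V by have := gV 0 i; rewrite mxE.
    rewrite -[V](mulmxKV uB2); apply: gen_mulmx => [i' l|i' l].
      by apply: gen_in; left; right; rewrite mem_cat [i']ord1 map_f ?orbT ?mem_enum.
    apply: gen_mono (gB2 i' l) => w [cw|Xw]; last by right.
    by left; left.
  elim: (genK z) => [y [[c <-]|/mapP[i _ ->]]||x y _ gx _ gy|x y _ gx _ gy] //.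
  - by apply: gen_in; left; left; exists c.
  - by rewrite rmorph1; apply: gen1.
  - by rewrite rmorphB; apply: genB.
  - by rewrite rmorphM fmorphV; apply: gen_div.
have gT_ : gen_mx SX T.
  have uB' : map_mx phi B \in unitmx by rewrite map_unitmx.
  rewrite -[T](mulmxK uB'); apply: gen_mulmx => //; apply: gen_invmx => i l.
  by rewrite mxE.
have genE z : gen SX z.
  apply: gen_t => // i; case/mxvec_indexP: i => i l.
  by have := gT_ i l; rewrite !mxE.
have fixS g z : g \in G -> S z -> A g z = z.
  move=> Gg [[c <-] //|]; rewrite mem_cat => /orP[zy|/mapP[i _ ->]].
    by apply: (ysfix g) => //; apply: AX.
  by have := congr1 (fun M : 'rV[E]_d => M 0 i) (AV' g Gg); rewrite mxE.
(* A matrix special over the larger field k(zs) is special over k(ys), hence comes from G, whose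
   action realizes it. *)
have fix_gen f : (forall g, g \in G -> A g f = f) -> gen S f.
  move=> fixf; apply: (lang_descent (eps := iE \o eps) uX gYS XY) => // C.
  move=> /(special_trans (fun z Sz => gen_in (Sys z Sz)))/spec[g Gg rgC].
  exists (A g); split=> [z|| ]; [exact: fixS| |exact: fixf].
  by rewrite AX // rgC -map_mx_comp.
have algE z : algebraic_in S z.
  apply: algebraic_in_trans (algebraic_in_gen (genE z)) => w [Sw|[i [l ->]]].
    exact: algebraic_in_base.
  by apply: power_matrix_algebraic gYS XY; rewrite ?finNzRing_gt1 //
    (card_pchar_nat (iE \o eps)).
pose xs := [seq phi (v i) | i <- enum 'I_d] ++ [seq t i | i <- enum 'I_(n * n)].
have ind_xs : alg_indep (constant iE) xs.
  apply: (alg_indep_cat (T := constant phi)).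
  - apply/(relation_freeP iE (phi \o v)).
    exact: (relation_free_comp iK phi v).1.
  - move=> z [[c <-]|/mapP[i _ ->]]; apply: gen_in; first by exists (iK c).
    by exists (v i).
  - exact/(relation_freeP phi t).
(* At most n * n + d elements, over which the n * n + d independent elements [xs] are algebraic. *)
have ind_zs : alg_indep (constant iE) zs.
  apply: alg_indep_of_size ind_xs _ _ => [|x _]; last exact: algE.
  by rewrite !size_cat !size_map -!enumT !size_enum_ord addnC leq_add2l.
have jfix z : S z -> exists p, j p = z.
  by move=> Sz; apply: imj => g Gg; apply: fixS.
have [zp zpE] : exists zp, map j zp = zs.
  have : {subset zs <= zs} by [].
  elim: {1 3}zs => [|z r IHr] rzs; first by exists [::].
  have [|zp <-] := IHr; first by move=> w wr; apply: rzs; rewrite inE wr orbT.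
  have [|p <-] := jfix z; first by right; apply: rzs; rewrite mem_head.
  by exists (p :: zp).
apply: (@purely_transcendental_of_free _ _ iP zp).
  apply/(relation_free_comp iP j) => p p0.
  suff /(relation_freeP iE (j \o tnth (in_tuple zp))) : alg_indep (constant iE)
      [seq (j \o tnth (in_tuple zp)) i | i <- enum 'I_(size zp)].
    apply; rewrite -[RHS]p0 /mmap; apply: eq_bigr => m _.
    by rewrite /= jiP.
  move: ind_zs; rewrite -zpE -[zp in map j zp](map_tnth_enum (in_tuple zp)).
  by rewrite -map_comp.
move=> z; apply: (gen_image (j := j) (T := S)).
  move=> x [[c <-]|xzs]; first by exists (iP c); [apply: gen_in; left; exists c|].
  move: xzs; rewrite -/zs -zpE => /mapP[p pz ->].
  by exists p => //; apply: gen_in; right.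
by apply: fix_gen => g Gg; apply: Aj.
Qed.

Theorem stably_rational_of_lang_data (k K L : fieldType) (gT : finGroupType)
    (G : {group gT}) n d (rV : mx_representation k G d)
    (rho : mx_representation k G n) (F : finFieldType) (eps : {rmorphism F -> k})
    (iK : {rmorphism k -> K}) (v : 'I_d -> K) (a : gT -> {rmorphism K -> K})
    (iL : {rmorphism k -> L}) (jL : {rmorphism L -> K}) :
  mx_faithful rV -> mx_faithful rho -> lang_data rho eps ->
  relation_free iK v ->
  (forall z, gen (adjoins (constant iK) [seq v i | i <- enum 'I_d]) z) ->
  (forall g c, a g (iK c) = iK c) ->
  (forall g j, g \in G -> a g (v j) = \sum_i v i * iK (rV g i j)) ->
  (forall g h z, g \in G -> h \in G -> a g (a h z) = a (g * h)%g z) ->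
  (forall x, (exists b, jL b = x) <-> (forall g, g \in G -> a g x = x)) ->
  (forall c, jL (iL c) = iK c) ->
  purely_transcendental (L := {fraction {mpoly L[n * n]}})
    (@frac_const (n * n) L \o iL).
Proof.
move=> fV frho data fv genK ac av aM fixL jLc.
have [j jE] := frac_mpoly_map (n * n) (@fmorph_inj _ _ jL).
have /fin_all_exists[A AE] g := frac_mpoly_map (n * n) (@fmorph_inj _ _ (a g)).
apply: (@lang_data_transcendental _ _ _ _ _ _ _ _ rV rho F eps iK v a
  (@frac_const _ K) (frac_var K) A (@frac_const _ L \o iL) j) => //.
- exact: frac_var_free.
- exact: gen_frac_var.
- exact: generic_matrix_unit.
- by move=> g z; rewrite /frac_const AE map_mpolyC.
- by move=> g i; rewrite /frac_var AE map_mpolyX.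
- move=> g h z Gg Gh; have [p [q [_ ->]]] := frac_ind z.
  rewrite !rmorphM !fmorphV !AE; congr (_%:F / _%:F);
    by apply/mpolyP => u; rewrite !mcoeff_map_mpoly; apply: aM.
- by move=> c; rewrite -jLc /= /frac_const jE map_mpolyC.
- move=> g z Gg; have [p [q [_ ->]]] := frac_ind z.
  rewrite !rmorphM !fmorphV !jE !AE; congr (_%:F / _%:F);
    by apply/mpolyP => u; rewrite !mcoeff_map_mpoly; apply: (fixL _).1 Gg; eexists.
- by move=> z; apply: (frac_mpoly_fixed jE AE aM) => x /fixL.
Qed.

Lemma quotient_stably_rational_of_lang_data (k : fieldType) (gT : finGroupType)
    (G : {group gT}) d (rV : mx_representation k G d) n
    (rho : mx_representation k G n) (F : finFieldType) (eps : {rmorphism F -> k}) :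
  mx_faithful rV -> mx_faithful rho -> lang_data rho eps ->
  quotient_stably_rational rV.
Proof.
move=> fV frho data; pose K : fieldType := {fraction {mpoly k[d]}}.
have /fin_all_exists[a aE] (g : gT) : exists alpha : {rmorphism K -> K},
    (g \in G -> forall z, alpha z = frac_map (polyfun_act rV g) z) /\
    forall c, alpha (frac_const d c) = frac_const d c.
  (* Outside [G] the matrix [rV g] is arbitrary; the identity is a default that still fixes the
     constants. *)
  case: (boolP (g \in G)) => [Gg|_]; last by exists idfun.
  have g_inj : injective (@FracField.tofrac _ \o polyfun_act rV g).
    by move=> p q /eqP; rewrite /= tofrac_eq => /eqP/(polyfun_act_inj Gg).
  have [alpha alphaE] := frac_lift g_inj; exists alpha; split=> [_ z|c].
    by rewrite {1}[z]fracE rmorphM fmorphV !alphaE.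
  by rewrite /frac_const alphaE /=; congr (_%:F); apply: comp_mpolyC.
have aF g p : g \in G -> a g p%:F = (polyfun_act rV g p)%:F.
  by move=> Gg; rewrite (aE g).1 // frac_map_tofrac //; apply: polyfun_act_inj.
pose iL c := invariant_const rV c.
have iLB : zmod_morphism iL.
  by move=> x y; apply/val_inj; rewrite /= mpolyCB tofracB.
have iLM : monoid_morphism iL.
  by split=> [|x y]; apply/val_inj; rewrite /= ?mpolyC1 ?tofrac1 // mpolyCM tofracM.
pose iLr : {rmorphism k -> invariant_field rV} := HB.pack iL
  (GRing.isZmodMorphism.Build _ _ iL iLB) (GRing.isMonoidMorphism.Build _ _ iL iLM).
pose jL : {rmorphism invariant_field rV -> K} := \val.
exists (n * n)%N.
apply: (@stably_rational_of_lang_data k K _ _ _ _ _ rV rho F eps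
  (@frac_const d k) (frac_var k) a iLr jL) => //.
- exact: frac_var_free.
- move=> z; apply: gen_frac_var => [c|i]; apply: gen_in.
    by left; exists c.
  by right; apply: map_f; rewrite mem_enum.
- by move=> g c; apply: (aE g).2.
- move=> g j Gg; rewrite /frac_var aF // /polyfun_act comp_mpolyXU -tnth_nth tnth_mktuple rmorph_sum /=.
  by apply: eq_bigr => i _; rewrite -mul_mpolyC tofracM mulrC.
- move=> g h z Gg Gh; have [p [q [q0 ->]]] := frac_ind z.
  have aD h' p' q' : a h' (p'%:F / q'%:F) = a h' p'%:F / a h' q'%:F.
    exact: fmorph_div.
  rewrite (aD h) !(aF h) // (aD g) (aD (g * h)%g) !(aF g) //.
  rewrite (aF _ p (groupM Gg Gh)) (aF _ q (groupM Gg Gh)).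
  by rewrite -(polyfun_act_comp rV p Gg Gh) -(polyfun_act_comp rV q Gg Gh).
- move=> x; split=> [[b <-] g Gg|fixx].
    by rewrite (aE g).1 //; have /forall_inP/(_ g Gg)/eqP := valP b.
  have Ix : x \in invariant_rational rV.
    by apply/forall_inP => g Gg; rewrite -(aE g).1 // fixx.
  by exists (SubfieldOf Ix).
Qed.

(** * Counting generators *)

Section GeneratorCounts.

Variables (E : fieldType).
Implicit Types (S : E -> Prop).

Lemma gen_adjoins S s z : gen S z -> gen (adjoins S s) z.
Proof. by apply: gen_mono => w; left. Qed.

Lemma gen_adjoins_cat S s1 s2 z :
  gen (adjoins (adjoins S s1) s2) z -> gen (adjoins S (s1 ++ s2)) z.
Proof.
apply: gen_mono => w [[Sw|w1]|w2]; [by left| |];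
  by right; rewrite mem_cat ?w1 ?w2 ?orbT.
Qed.

(** Gaussian elimination: after a change of coordinates over the subfield, the known product y A
    determines the first [\rank A] coordinates of y; the remaining ones are the new generators. *)
Lemma gen_row_linear S n r (y : 'rV[E]_n) (A : 'M[E]_(n, r)) :
  gen_mx S A -> gen_mx S (y *m A) ->
  exists s : seq E, [/\ (size s <= n - \rank A)%N,
    forall z, z \in s -> gen (fun w => S w \/ entries y w) z
    & gen_mx (adjoins S s) y].
Proof.
move=> gA gyA; have [M [iota genE]] := gen_field S.
have [A' AE] := gen_lift_mx genE gA; set k := \rank A.
have kE : \rank A' = k by rewrite /k -AE mxrank_map.
have gM m p (B : 'M[M]_(m, p)) : gen_mx S (map_mx iota B).
  by move=> i j; rewrite mxE; apply/genE; eexists.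
pose c := map_mx iota (col_ebase A'); pose b := map_mx iota (row_ebase A').
have uc : c \in unitmx by rewrite map_unitmx col_ebase_unit.
have ub : b \in unitmx by rewrite map_unitmx row_ebase_unit.
pose z := y *m c; pose l := [seq z 0 i | i <- enum 'I_n].
have nthl (i : 'I_n) : nth 0 l i = z 0 i.
  by rewrite (nth_map i) ?size_enum_ord // nth_ord_enum.
have sl : size l = n by rewrite size_map size_enum_ord.
exists (drop k l); split; first by rewrite size_drop sl.
  move=> w /mem_drop/mapP[i _ ->]; rewrite mxE; apply: gen_sum => a _.
  apply: genM; first by apply: gen_in; right; exists 0, a.
  by apply: gen_mono (gM _ _ (col_ebase A') a i) => u; left.
have zk : gen_mx S (z *m pid_mx k : 'rV_r).
  rewrite -[_ *m _](mulmxK ub); apply: gen_mulmx; last first.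
    by apply: gen_invmx; apply: gM.
  rewrite -(map_pid_mx iota) -!mulmxA -!map_mxM mulmxA -kE mulmx_ebase AE.
  exact: gyA.
suff gz : gen_mx (adjoins S (drop k l)) z.
  rewrite -[y](mulmxK uc); apply: gen_mulmx => // i j.
  by apply: gen_adjoins; apply: gen_invmx; apply: gM.
move=> i0 i; rewrite [i0]ord1; case: (ltnP i k) => ik.
  have kr : (k <= r)%N by apply: rank_leq_col.
  apply: gen_adjoins; have := zk 0 (Ordinal (leq_trans ik kr)).
  rewrite mxE (bigD1 i) //= [pid_mx _ _ _]mxE eqxx ik mulr1 big1 ?addr0 // => a ai.
  by rewrite [pid_mx _ _ _]mxE -val_eqE in ai *; rewrite (negPf ai) mulr0.
apply: gen_in; right; rewrite -nthl -(subnKC ik) -nth_drop mem_nth //.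
by rewrite size_drop sl ltn_sub2r // (leq_ltn_trans ik).
Qed.

Lemma gen_matrix_det S n (Y : 'M[E]_n.+1) :
  Y \in unitmx -> gen S (\det Y) ->
  exists s : seq E, [/\ (size s < n.+1 * n.+1)%N,
    forall z, z \in s -> gen (fun w => S w \/ entries Y w) z
    & gen_mx (adjoins S s) Y].
Proof.
move=> uY gdet; pose Y' := row' ord_max Y.
pose s0 := [seq Y' p.1 p.2 | p <- enum {: 'I_n * 'I_n.+1}].
pose S1 := adjoins S s0.
have gY' : gen_mx S1 Y'.
  move=> i j; apply: gen_in; right; apply/mapP; exists (i, j) => //.
  by rewrite mem_enum.
(* The determinant is an affine condition on the last row given the others.    *)
pose A : 'cV[E]_n.+1 := \col_j cofactor Y ord_max j.
have yA : row ord_max Y *m A = (\det Y)%:M.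
  apply/matrixP => i j; rewrite [i]ord1 [j]ord1 !mxE eqxx mulr1n.
  by rewrite (expand_det_row _ ord_max); apply: eq_bigr => l _; rewrite !mxE.
have [||s1 [size1 s1Y gy]] := @gen_row_linear S1 _ _ (row ord_max Y) A.
- move=> i j; rewrite mxE /cofactor; apply: genM.
    by apply: genX; apply: genN; apply: gen1.
  by apply: gen_det => a b; have := gY' a (lift i b); rewrite !mxE.
- rewrite yA => i j; rewrite mxE; case: eqP => _; last exact: gen0.
  exact: gen_adjoins.
exists (s0 ++ s1); split.
- rewrite size_cat size_map -cardE card_prod !card_ord.
  have rA : (0 < \rank A)%N.
    rewrite lt0n mxrank_eq0; apply/eqP => A0; move: uY; rewrite unitmxE unitfE.
    by have := congr1 (fun M : 'M_1 => M 0 0) yA;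
      rewrite A0 mulmx0 !mxE eqxx mulr1n => <-; rewrite eqxx.
  rewrite mulSn addnC ltn_add2r (leq_ltn_trans size1) // ltnS leq_subLR.
  exact: (leq_add rA (leqnn n)).
- have Yg z : z \in s0 -> gen (fun w => S w \/ entries Y w) z.
    by case/mapP=> p _ ->; apply: gen_in; right; exists (lift ord_max p.1), p.2; rewrite mxE.
  move=> z; rewrite mem_cat => /orP[/Yg //|/s1Y].
  apply: gen_trans => w [[Sw|/Yg //]|[i [j ->]]]; first by apply: gen_in; left.
  by apply: gen_in; right; exists ord_max, j; rewrite mxE.
- move=> i j; apply: gen_adjoins_cat; case: (unliftP ord_max i) => [i' ->|->].
    by have := gY' i' j; rewrite mxE; apply: gen_adjoins.
  by have := gy 0 j; rewrite mxE.
Qed.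

Lemma gen_matrix_gram S N (Y T : 'M[E]_N) :
  Y \in unitmx -> T \in unitmx -> gen_mx S T -> gen_mx S (Y *m T *m Y^T) ->
  exists s : seq E, [/\ (size s <= \sum_(i < N) (N - i))%N,
    forall z, z \in s -> gen (fun w => S w \/ entries Y w) z
    & gen_mx (adjoins S s) Y].
Proof.
move=> uY uT gT gG.
suff rec i : (i <= N)%N -> exists s : seq E, [/\ (size s <= \sum_(l < i) (N - l))%N,
    forall z, z \in s -> gen (fun w => S w \/ entries Y w) z
    & forall a b : 'I_N, (a < i)%N -> gen (adjoins S s) (Y a b)].
  have [s [h1 h2 h3]] := rec N (leqnn N).
  by exists s; split=> // a b; apply: h3.
elim: i => [_|i IHi lti].
  by exists [::]; rewrite big_ord0; split.
have [s [size_s sY gY]] := IHi (ltnW lti).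
pose f (a : 'I_i) : 'I_N := widen_ord (ltnW lti) a; pose i' := Ordinal lti.
(* Row i has prescribed pairings with the i independent rows before it.        *)
pose A := T *m (rowsub f Y)^T.
have gsY a : gen_mx (adjoins S s) (row (f a) Y).
  by move=> x y; rewrite mxE; apply: gY; apply: (ltn_ord a).
have [||s1 [size1 s1Y gy]] := @gen_row_linear (adjoins S s) _ _ (row i' Y) A.
- apply: gen_mulmx => [a b|a b]; first exact: gen_adjoins.
  by rewrite !mxE; apply: gY; apply: (ltn_ord b).
- move=> a b; have -> : (row i' Y *m A) a b = (Y *m T *m Y^T) i' (f b).
    rewrite mulmxA -row_mul !mxE; apply: eq_bigr => l _.
    by rewrite !mxE.
  exact: gen_adjoins.
(* The rows of the invertible matrix [Y] are independent and [T] is invertible, so the i equations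
   are independent. *)
have rA : \rank A = i.
  rewrite /A -mxrank_tr trmx_mul trmxK mxrankMfree; last first.
    by rewrite row_free_unit unitmx_tr.
  apply/eqP; rewrite -/(row_free _); apply/row_freeP.
  exists (invmx Y *m (rowsub f 1%:M)^T); apply/matrixP => a b.
  transitivity ((Y *m (invmx Y *m (rowsub f 1%:M)^T)) (f a) b).
    by rewrite !mxE; apply: eq_bigr => l _; rewrite !mxE.
  by rewrite mulKVmx // !mxE -!val_eqE /= eq_sym.
exists (s ++ s1); split.
- by rewrite size_cat big_ord_recr /= leq_add // -rA.
- move=> z; rewrite mem_cat => /orP[/sY //|/s1Y].
  apply: gen_trans => w [[Sw|/sY //]|[x [y ->]]]; first by apply: gen_in; left.
  by apply: gen_in; right; exists i', y; rewrite mxE.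
- move=> a b; rewrite ltnS leq_eqVlt => /predU1P[ai|lta]; apply: gen_adjoins_cat.
    have := gy 0 b; rewrite mxE (_ : i' = a) //; exact/val_inj.
  exact/gen_adjoins/gY.
Qed.

Lemma gen_alternating N (T : 'M[E]_N) :
  (forall i j, T i j = - T j i) -> (forall i, T i i = 0) ->
  exists s : seq E, [/\ (size s <= \sum_(i < N) i)%N,
    forall z, z \in s -> entries T z
    & forall S, gen_mx (adjoins S s) T].
Proof.
case: N T => [|N] T antiT altT; first by exists [::]; split=> // S [].
exists [seq T (inord i) (inord j) | i <- iota 0 N.+1, j <- iota 0 i]; split.
- rewrite size_allpairs_dep sumnE big_map -{1}(subn0 N.+1) -/(index_iota _ _).
  by rewrite big_mkord; apply: leq_sum => i _; rewrite size_iota.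
- by move=> z /allpairsPdep[i [j [_ _ ->]]]; exists (inord i), (inord j).
move=> S; have lower (i j : 'I_N.+1) : (j < i)%N -> gen (adjoins S
    [seq T (inord i) (inord j) | i <- iota 0 N.+1, j <- iota 0 i]) (T i j).
  move=> ji; apply: gen_in; right; apply/allpairsPdep; exists (val i), (val j).
  by rewrite !mem_iota /= !add0n ltn_ord ji !inord_val.
move=> i j; case: (ltngtP i j) => [ij|ij|/val_inj->].
- by rewrite antiT; apply: genN; apply: lower.
- exact: lower.
- by rewrite altT; apply: gen0.
Qed.

(** A matrix Y with prescribed Gram matrix and an alternating matrix T together cost N * N
    generators. *)
Lemma sum_gram_alternating N :
  (\sum_(i < N) (N - i) + \sum_(i < N) i = N * N)%N.
Proof.
rewrite -big_split (eq_bigr (fun=> N)) ?sum_nat_const ?card_ord // => i _.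
by rewrite /= subnK // ltnW.
Qed.

End GeneratorCounts.

(** * Special linear, unitary and symplectic groups *)

Section CorrespondenceMatrices.

Variables (E : fieldType) (F : finFieldType) (eps : {rmorphism F -> E}) (n : nat).
Variables (X : 'M[E]_n) (S : E -> Prop).

Definition corr_mx a b (H : 'M[F]_n -> 'M[E]_(a, b)) :=
  forall i j, corr eps X S (fun C => H C i j).

Lemma corr_sum (I : Type) (r : seq I) (h : I -> 'M[F]_n -> E) :
  (forall i, corr eps X S (h i)) -> corr eps X S (fun C => \sum_(i <- r) h i C).
Proof.
move=> ch; elim: r => [|i r IHr].
  by apply: corr_ext (corr_const _ _ (gen0 S)) => C; rewrite big_nil.
by apply: corr_ext (corrD (ch i) IHr) => C; rewrite big_cons.
Qed.

Lemma corr_prod (I : Type) (r : seq I) (h : I -> 'M[F]_n -> E) :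
  (forall i, corr eps X S (h i)) -> corr eps X S (fun C => \prod_(i <- r) h i C).
Proof.
move=> ch; elim: r => [|i r IHr].
  by apply: corr_ext (corr_const _ _ (gen1 S)) => C; rewrite big_nil.
by apply: corr_ext (corrM (ch i) IHr) => C; rewrite big_cons.
Qed.

Lemma corrX h q : corr eps X S h -> corr eps X S (fun C => h C ^+ q).
Proof.
move=> ch; have := corr_prod (nseq q tt) (fun=> ch).
by apply: corr_ext => C; rewrite big_nseq iter_mulr_1.
Qed.

Lemma corr_mx_coord : corr_mx (fun C => X *m map_mx eps C).
Proof. by move=> i j; apply: corr_coord. Qed.

Lemma corr_mx_const a b (A : 'M[E]_(a, b)) : gen_mx S A -> corr_mx (fun=> A).
Proof. by move=> gA i j; apply: corr_const. Qed.

Lemma corr_mulmx a b c (H : _ -> 'M[E]_(a, b)) (H' : _ -> 'M[E]_(b, c)) :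
  corr_mx H -> corr_mx H' -> corr_mx (fun C => H C *m H' C).
Proof.
move=> cH cH' i j; have := corr_sum (index_enum _) (fun l => corrM (cH i l) (cH' l j)).
by apply: corr_ext => C; rewrite mxE.
Qed.

Lemma corr_trmx a b (H : _ -> 'M[E]_(a, b)) :
  corr_mx H -> corr_mx (fun C => (H C)^T).
Proof. by move=> cH i j; apply: corr_ext (cH j i) => C; rewrite mxE. Qed.

Lemma corr_power_mx q a b (H : _ -> 'M[E]_(a, b)) :
  corr_mx H -> corr_mx (fun C => map_mx (fun x => x ^+ q) (H C)).
Proof. by move=> cH i j; apply: corr_ext (corrX q (cH i j)) => C; rewrite mxE. Qed.

Lemma corr_det a (H : _ -> 'M[E]_a) :
  corr_mx H -> corr eps X S (fun C => \det (H C)).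
Proof.
move=> cH; have := corr_sum (index_enum _) (fun s : 'S_a =>
  corrM (corr_const _ _ (genX s (genN (gen1 S))))
        (corr_prod (index_enum _) (fun i => cH i (s i)))).
by apply: corr_ext.
Qed.

(** A polynomial in X with value in the subfield keeps that value under specialization; thus a
    special C preserves the chosen invariants of X. *)
Lemma special_eq C h c : special eps X S C -> corr eps X S h -> gen S c ->
  h 1%:M = c -> h C = c.
Proof.
move=> spC ch gc h1; apply/eqP; rewrite -subr_eq0; apply/eqP.
apply: (spC (fun C => h C - c)); last by rewrite h1 subrr.
exact: (corrD ch (corr_const _ _ (genN gc))).
Qed.

Lemma special_eq_mx C a b (H : _ -> 'M[E]_(a, b)) K :
  special eps X S C -> corr_mx H -> gen_mx S K -> H 1%:M = K -> H C = K.
Proof.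
move=> spC cH gK H1; apply/matrixP => i j.
by apply: (special_eq spC (cH i j)) => //; rewrite H1.
Qed.

End CorrespondenceMatrices.

Lemma gen_fixed (E : fieldType) (alpha : {rmorphism E -> E}) (S : E -> Prop) z :
  (forall x, S x -> alpha x = x) -> gen S z -> alpha z = z.
Proof.
move=> aS; elim=> [y /aS //||a b _ ea _ eb|a b _ ea _ eb]; first exact: rmorph1.
  by rewrite rmorphB ea eb.
by rewrite rmorphM fmorphV ea eb.
Qed.

Lemma mulmx_invmx_cancel (E : fieldType) n (A B R : 'M[E]_n) :
  B \in unitmx -> R \in unitmx -> (A *m R) *m invmx (B *m R) = A *m invmx B.
Proof.
move=> uB uR; have uBR : B *m R \in unitmx by rewrite unitmx_mul uB.
by apply: (can_inj (mulmxK uBR)); rewrite mulmxKV // mulmxA mulmxKV.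
Qed.

(** * The standard symplectic form *)

Section SymplecticForm.

Variables (E : fieldType) (n : nat).
Local Notation J := (symplectic_form E n).

Lemma symplectic_form_tr : J^T = - J.
Proof.
by rewrite tr_block_mx opp_block_mx !trmx0 raddfN /= !trmx1 ?oppr0 opprK.
Qed.

Lemma symplectic_form_sqr : J *m J = - 1%:M.
Proof.
rewrite mulmx_block !mul0mx !mulmx0 !mul1mx mulmx1 !add0r !addr0.
by rewrite (scalar_mx_block n n) opp_block_mx !oppr0.
Qed.

Lemma symplectic_form_unit : J \in unitmx.
Proof.
have /mulmx1_unit[] // : J *m (- J) = 1%:M.
by rewrite mulmxN symplectic_form_sqr opprK.
Qed.

Lemma symplectic_form_alternate (x : 'rV[E]_(n + n)) : x *m J *m x^T = 0.
Proof.
rewrite -[x]hsubmxK; set l := lsubmx x; set r := rsubmx x.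
rewrite mul_row_block tr_row_mx mul_row_col !mulmx0 add0r addr0 mulmxN !mulmx1.
rewrite mulNmx -{1}[r]trmxK -trmx_mul.
suff -> : (l *m r^T)^T = l *m r^T by rewrite addNr.
by apply/matrixP => i j; rewrite [i]ord1 [j]ord1 mxE.
Qed.

(** The defining relation exhibits a left inverse of A; that it is also a right inverse is the
    transposed relation. *)
Lemma symplecticP (A : 'M[E]_(n + n)) : symplectic A <-> A *m J *m A^T = J.
Proof.
suff tr B : B^T *m J *m B = J -> B *m J *m B^T = J.
  by split=> [/tr //|AJ]; apply: etrans (tr A^T _); rewrite trmxK.
move=> BJ; have : (- J *m B^T *m J) *m B = 1%:M.
  by rewrite -!mulmxA !mulNmx mulmxA BJ symplectic_form_sqr opprK.
move/mulmx1C; rewrite mulNmx mulNmx mulmxN => /(congr1 (fun M => M *m J)).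
rewrite mul1mx mulNmx !mulmxA -[_ *m J *m J]mulmxA symplectic_form_sqr.
by rewrite mulmxN mulmx1 opprK.
Qed.

Lemma symplectic_unitmx (A : 'M[E]_(n + n)) : symplectic A -> A \in unitmx.
Proof.
move=> sA; have : A^T *m J *m A \in unitmx by rewrite sA symplectic_form_unit.
by rewrite unitmx_mul => /andP[].
Qed.

Lemma symplecticM (A B : 'M[E]_(n + n)) :
  symplectic A -> symplectic B -> symplectic (A *m B).
Proof.
move=> sA sB; have : B^T *m (A^T *m J *m A) *m B = J by rewrite sA sB.
by rewrite /symplectic trmx_mul !mulmxA.
Qed.

Lemma symplecticV (A : 'M[E]_(n + n)) : symplectic A -> symplectic (invmx A).
Proof.
move=> sA; have uA := symplectic_unitmx sA.
rewrite /symplectic -{1}sA trmx_inv -!mulmxA mulmxV // mulmx1 mulmxA.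
by rewrite mulVmx ?mul1mx // unitmx_tr.
Qed.

End SymplecticForm.

Lemma map_symplectic_form (F E : fieldType) (f : {rmorphism F -> E}) n :
  map_mx f (symplectic_form F n) = symplectic_form E n.
Proof. by rewrite map_block_mx map_mx0 map_mxN map_mx1. Qed.

Lemma symplectic_alternating (E : fieldType) n N (X : 'M[E]_(N, n + n)) :
  let T := X *m symplectic_form E n *m X^T in
  (forall i j, T i j = - T j i) /\ forall i, T i i = 0.
Proof.
move=> T; split=> [i j|i].
  have : T^T = - T.
    by rewrite /T !trmx_mul trmxK symplectic_form_tr mulmxA mulmxN mulNmx.
  by move/matrixP/(_ j i); rewrite !mxE.
transitivity ((row i X *m symplectic_form E n *m (row i X)^T) 0 0).
  by rewrite /T tr_row -!row_mul [RHS]mxE; rewrite !mxE; apply: eq_bigr => l _; rewrite !mxE.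
by rewrite symplectic_form_alternate mxE.
Qed.

(** * Lang data of the classical groups *)

Section LangData.

Variables (k : fieldType) (F : finFieldType) (eps : {rmorphism F -> k}).
Variables (gT : finGroupType) (G : {group gT}).

Lemma frobenius_fixed (E : fieldType) (iota : {rmorphism F -> E})
    (phi : E -> E) m n (C : 'M[F]_(m, n)) :
  (forall x, phi x = x ^+ #|F|) -> map_mx phi (map_mx iota C) = map_mx iota C.
Proof.
by move=> phiE; apply/matrixP => i j; rewrite !mxE phiE -rmorphXn expf_card.
Qed.

Lemma rmorph_powerC (E E' : fieldType) (alpha : {rmorphism E -> E'}) q m n
    (A : 'M[E]_(m, n)) :
  map_mx alpha (map_mx (fun x => x ^+ q) A) =
  map_mx (fun x => x ^+ q) (map_mx alpha A).
Proof. by apply/matrixP => i j; rewrite !mxE rmorphXn. Qed.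

(** Since det Y is a power of det X up to division by det X, one entry of Y is saved by
    [gen_matrix_det], which makes room for det X. Specialization preserves det X and so forces det C
    = 1. *)
Lemma SL_lang_data n (rho : mx_representation F G n) : (0 < n)%N ->
  (forall A, special_linear A <-> exists2 g, g \in G & rho g = A) ->
  lang_data (map_repr eps rho) eps.
Proof.
case: n rho => // n rho _ SLP E iota X uX.
have [phi phiE] := power_rmorphism (card_pchar_nat (iota \o eps)).
have eq_phi m p (A : 'M[E]_(m, p)) : map_mx (fun x => x ^+ #|F|) A = map_mx phi A.
  by apply/matrixP => i j; rewrite !mxE phiE.
pose Y := map_mx phi X *m invmx X; pose d := \det X.
have uY : Y \in unitmx by rewrite unitmx_mul map_unitmx uX unitmx_inv.
pose S0 := adjoins (constant iota) [:: d].
have gd : gen S0 d by apply: gen_in; right; rewrite mem_head.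
have gdetY : gen S0 (\det Y).
  by rewrite det_mulmx det_inv det_map_mx phiE; apply: gen_div => //; apply: genX.
have [s [size_s sY gY]] := gen_matrix_det uY gdetY.
exists (d :: s), Y; split.
- exact: size_s.
- move=> g alpha Gg ac aX; rewrite map_reprE -map_mx_comp in aX.
  have ad : alpha d = d.
    rewrite /d -det_map_mx aX det_mulmx det_map_mx.
    by rewrite ((SLP (rho g)).2 _) ?rmorph1 ?mulr1 //; exists g.
  have aY : map_mx alpha Y = Y.
    rewrite /Y map_mxM map_invmx -eq_phi rmorph_powerC aX !eq_phi map_mxM.
    rewrite (frobenius_fixed (iota \o eps) _ phiE).
    by apply: mulmx_invmx_cancel; rewrite // map_unitmx repr_mx_unit.
  move=> y; rewrite inE => /predU1P[->//|/sY]; apply: gen_fixed => w.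
  case=> [[[c <-]|]|[i [j ->]]]; first exact: ac.
    by rewrite inE => /eqP->.
  by have := congr1 (fun M : 'M[E]_n.+1 => M i j) aY; rewrite mxE.
- move=> i j; apply: gen_mono (gY i j) => w [[Sw|]|ws]; first by left.
    by rewrite inE => /eqP->; right; rewrite mem_head.
  by right; rewrite inE ws orbT.
- by rewrite eq_phi mulmxKV.
move=> C spC.
have /(congr1 (fun x => d^-1 * x)) : \det (X *m map_mx (iota \o eps) C) = d.
  apply: (special_eq spC (h := fun C => \det (X *m map_mx (iota \o eps) C))).
  - exact/corr_det/corr_mx_coord.
  - by apply: gen_in; right; rewrite mem_head.
  - by rewrite map_scalar_mx rmorph1 mulmx1.
have d0 : d != 0 by rewrite -unitfE -unitmxE.
rewrite det_mulmx mulKf // mulVf // det_map_mx => /eqP; rewrite fmorph_eq1 => /eqP.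
by move/SLP=> [g Gg <-]; exists g => //; rewrite map_reprE.
Qed.

(** Here the generators are det X and all but one of the entries of H. That H is preserved says that
    C is unitary. *)
Lemma SU_lang_data q n (rho : mx_representation F G n) : (0 < n)%N ->
  #|F| = (q ^ 2)%N ->
  (forall A, special_unitary q A <-> exists2 g, g \in G & rho g = A) ->
  lang_data (map_repr eps rho) eps.
Proof.
case: n rho => // n rho _ Fq SUP E iota X uX.
have pq : [pchar E].-nat q.
  by have := card_pchar_nat (iota \o eps); rewrite Fq pnatX orbF.
have [psi psiE] := power_rmorphism pq.
have eq_psi m p (A : 'M[E]_(m, p)) : map_mx (fun x => x ^+ q) A = map_mx psi A.
  by apply/matrixP => i j; rewrite !mxE psiE.
pose d := \det X; pose U := (map_mx psi X)^T; pose H := X *m U.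
have uU : U \in unitmx by rewrite unitmx_tr map_unitmx.
have uH : H \in unitmx by rewrite unitmx_mul uX.
(* H = X psi(X)^T gives psi(psi(X)) = psi(H)^T H^-1 X.                         *)
pose Y := (map_mx psi H)^T *m invmx H.
pose S0 := adjoins (constant iota) [:: d].
have gd : gen S0 d by apply: gen_in; right; rewrite mem_head.
have gdetH : gen S0 (\det H).
  by rewrite det_mulmx det_tr det_map_mx psiE; apply: genM => //; apply: genX.
have [s [size_s sH gH]] := gen_matrix_det uH gdetH.
have gHs : gen_mx (adjoins (constant iota) (d :: s)) H.
  move=> i j; apply: gen_mono (gH i j) => w [[Sw|]|ws]; first by left.
    by rewrite inE => /eqP->; right; rewrite mem_head.
  by right; rewrite inE ws orbT.
have XU C : map_mx psi (X *m map_mx (iota \o eps) C) =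
    map_mx psi X *m map_mx (iota \o eps) (map_mx (fun x => x ^+ q) C).
  rewrite map_mxM; congr (_ *m _); apply/matrixP => i j.
  by rewrite !mxE psiE -rmorphXn.
exists (d :: s), Y; split.
- exact: size_s.
- move=> g alpha Gg ac aX; rewrite map_reprE -map_mx_comp in aX.
  have [unit_g det_g] := (SUP (rho g)).2 (ex_intro2 _ _ g Gg erefl).
  have ad : alpha d = d.
    by rewrite /d -det_map_mx aX det_mulmx det_map_mx det_g rmorph1 mulr1.
  have aH : map_mx alpha H = H.
    rewrite /H /U map_mxM -map_trmx -eq_psi rmorph_powerC aX !eq_psi XU.
    rewrite trmx_mul mulmxA -[X *m _ *m _]mulmxA [(map_mx (iota \o eps) _)^T]map_trmx -map_mxM unit_g.
    by rewrite map_scalar_mx rmorph1 mulmx1.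
  move=> y; rewrite inE => /predU1P[->//|/sH]; apply: gen_fixed => w.
  case=> [[[c <-]|]|[i [j ->]]]; first exact: ac.
    by rewrite inE => /eqP->.
  by have := congr1 (fun M : 'M[E]_n.+1 => M i j) aH; rewrite mxE.
- apply: gen_mulmx; last exact: gen_invmx.
  by rewrite -eq_psi; apply: gen_trmx; apply: gen_power_mx.
- transitivity (map_mx psi (map_mx psi X)).
    by apply/matrixP => i j; rewrite !mxE !psiE -exprM mulnn Fq.
  rewrite /Y /H map_mxM trmx_mul /U -map_trmx trmxK -/U -/H -!mulmxA.
  suff -> : U *m (invmx H *m X) = 1%:M by rewrite mulmx1.
  by rewrite mulmxA; apply: mulmx1C; rewrite mulmxA mulmxV.
move=> C spC.
have detC : \det (X *m map_mx (iota \o eps) C) = d.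
  apply: (special_eq spC (h := fun C => \det (X *m map_mx (iota \o eps) C))).
  - exact/corr_det/corr_mx_coord.
  - by apply: gen_in; right; rewrite mem_head.
  - by rewrite map_scalar_mx rmorph1 mulmx1.
have HC : (X *m map_mx (iota \o eps) C) *m
    (map_mx (fun x => x ^+ q) (X *m map_mx (iota \o eps) C))^T = H.
  apply: (special_eq_mx spC (H := fun C => (X *m map_mx (iota \o eps) C) *m
    (map_mx (fun x => x ^+ q) (X *m map_mx (iota \o eps) C))^T)) => //.
    apply: corr_mulmx; first exact: corr_mx_coord.
    exact/corr_trmx/corr_power_mx/corr_mx_coord.
  by rewrite map_scalar_mx rmorph1 mulmx1 eq_psi.
have d0 : d != 0 by rewrite -unitfE -unitmxE.
suff /SUP[g Gg <-] : special_unitary q C by exists g => //; rewrite map_reprE.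
split; last first.
  apply/eqP; rewrite -(fmorph_eq1 (iota \o eps)) -det_map_mx.
  by rewrite -(inj_eq (mulfI d0)) mulr1 -det_mulmx detC.
apply: (map_mx_inj (f := iota \o eps)); rewrite map_scalar_mx rmorph1.
apply: (can_inj (mulmxK uU)); apply: (can_inj (mulKmx uX)).
rewrite mul1mx -[RHS]/H -HC eq_psi XU trmx_mul map_mxM -map_trmx -/U !mulmxA.
by [].
Qed.

(** The lower entries of the alternating matrix T come first; over them Y has the known Gram matrix
    Y T Y^T = F(T). That T is preserved says that C is symplectic. *)
Lemma Sp_lang_data n (rho : mx_representation F G (n + n)) :
  (forall A, symplectic A <-> exists2 g, g \in G & rho g = A) ->
  lang_data (map_repr eps rho) eps.
Proof.
move=> SpP E iota X uX; pose J := symplectic_form E n.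
have [phi phiE] := power_rmorphism (card_pchar_nat (iota \o eps)).
have eq_phi m p (A : 'M[E]_(m, p)) : map_mx (fun x => x ^+ #|F|) A = map_mx phi A.
  by apply/matrixP => i j; rewrite !mxE phiE.
pose Y := map_mx phi X *m invmx X; pose T := X *m J *m X^T.
have uY : Y \in unitmx by rewrite unitmx_mul map_unitmx uX unitmx_inv.
have uT : T \in unitmx by rewrite !unitmx_mul unitmx_tr uX symplectic_form_unit.
have [antiT altT] := symplectic_alternating X.
have [s1 [size1 s1T gT_]] := gen_alternating antiT altT.
have YTY : Y *m T *m Y^T = map_mx phi T.
  rewrite /T !map_mxM (map_symplectic_form phi) -map_trmx /Y trmx_mul trmx_inv.
  have uXt : X^T \in unitmx by rewrite unitmx_tr.
  by rewrite !mulmxA mulmxKV // mulmxK.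
have [|s2 [size2 s2Y gY]] := @gen_matrix_gram _ (adjoins (constant iota) s1) _ Y T
  uY uT (gT_ _).
  by rewrite YTY -eq_phi; apply: gen_power_mx; apply: gT_.
exists (s1 ++ s2), Y; split.
- by rewrite size_cat addnC -sum_gram_alternating leq_add.
- move=> g alpha Gg ac aX; rewrite map_reprE -map_mx_comp in aX.
  have /symplecticP Jg := (SpP (rho g)).2 (ex_intro2 _ _ g Gg erefl).
  have aT : map_mx alpha T = T.
    rewrite /T !map_mxM -map_trmx aX (map_symplectic_form alpha) trmx_mul [(map_mx (iota \o eps) _)^T]map_trmx.
    rewrite /J -(map_symplectic_form (iota \o eps)) !mulmxA.
    by rewrite -[X *m _ *m _]mulmxA -map_mxM -[X *m _ *m _]mulmxA -map_mxM Jg.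
  have aY : map_mx alpha Y = Y.
    rewrite /Y map_mxM map_invmx -eq_phi rmorph_powerC aX !eq_phi map_mxM.
    rewrite (frobenius_fixed (iota \o eps) _ phiE).
    by apply: mulmx_invmx_cancel; rewrite // map_unitmx repr_mx_unit.
  have as1 y : y \in s1 -> alpha y = y.
    move=> /s1T[i [j ->]].
    by have := congr1 (fun M : 'M[E]_(n + n) => M i j) aT; rewrite mxE.
  move=> y; rewrite mem_cat => /orP[/as1 //|/s2Y]; apply: gen_fixed => w.
  case=> [[[c <-]|/as1 //]|[i [j ->]]]; first exact: ac.
  by have := congr1 (fun M : 'M[E]_(n + n) => M i j) aY; rewrite mxE.
- by move=> i j; apply: gen_adjoins_cat.
- by rewrite eq_phi mulmxKV.
move=> C spC.
have TC : (X *m map_mx (iota \o eps) C) *m J *m (X *m map_mx (iota \o eps) C)^T = T.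
  apply: (special_eq_mx spC (H := fun C => (X *m map_mx (iota \o eps) C) *m J *m
    (X *m map_mx (iota \o eps) C)^T)) => //.
  - apply: corr_mulmx; last exact/corr_trmx/corr_mx_coord.
    apply: corr_mulmx; first exact: corr_mx_coord.
    apply: corr_mx_const; rewrite /J -(map_symplectic_form iota) => i j.
    by rewrite mxE; apply: gen_in; left; eexists.
  - move=> i j; apply: gen_mono (gT_ (constant iota) i j) => w [cw|ws].
      by left.
    by right; rewrite mem_cat ws.
  - by rewrite map_scalar_mx rmorph1 mulmx1.
suff /symplecticP/SpP[g Gg <-] : C *m symplectic_form F n *m C^T = symplectic_form F n.
  by exists g => //; rewrite map_reprE.
apply: (map_mx_inj (f := iota \o eps)).
have uXt : X^T \in unitmx by rewrite unitmx_tr.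
apply: (can_inj (mulmxK uXt)); apply: (can_inj (mulKmx uX)).
rewrite !map_mxM -map_trmx (map_symplectic_form (iota \o eps)) -/J.
by rewrite [X *m (J *m _)]mulmxA -/T -TC trmx_mul !mulmxA.
Qed.

End LangData.

(** * Suzuki groups *)

Local Notation o := (@inord 3).

Lemma ord4_ind (P : 'I_4 -> Prop) :
  P (o 0) -> P (o 1) -> P (o 2) -> P (o 3) -> forall i, P i.
Proof.
move=> P0 P1 P2 P3 i; rewrite -[i]inord_val.
by case: i => -[|[|[|[|//]]]].
Qed.

Lemma sum_ord4 (E : nmodType) (f : 'I_4 -> E) :
  \sum_i f i = f (o 0) + f (o 1) + f (o 2) + f (o 3).
Proof.
rewrite (eq_bigr (fun i : 'I_4 => f (o i))); last by move=> i; rewrite inord_val.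
by rewrite !big_ord_recl big_ord0 addr0 !addrA.
Qed.

Lemma symplectic_form4E (E : fieldType) (i j : 'I_4) :
  symplectic_form E 2 i j = (i + 2 == j)%N%:R - (j + 2 == i)%N%:R.
Proof.
rewrite /symplectic_form mxE; case: splitP => i' ei; rewrite !mxE;
  case: splitP => j' ej; rewrite !mxE ei ej; case: i' {ei} => -[|[|//]] ?;
  case: j' {ej} => -[|[|//]] ?; rewrite -?val_eqE //= ?subrr ?sub0r ?subr0 ?oppr0 //.
Qed.

Definition row_pairing (E : fieldType) (A : 'M[E]_4) (i j : 'I_4) : E :=
  A i (o 0) * A j (o 2) - A i (o 2) * A j (o 0) +
  (A i (o 1) * A j (o 3) - A i (o 3) * A j (o 1)).

Lemma row_pairingE (E : fieldType) (A : 'M[E]_4) i j :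
  (A *m symplectic_form E 2 *m A^T) i j = row_pairing A i j.
Proof.
rewrite !mxE sum_ord4 !mxE !sum_ord4 !symplectic_form4E /row_pairing !inordK //=.
ring.
Qed.

(** * The exceptional isogeny of Sp_4 *)

Section CharacteristicTwo.

Variable E : fieldType.
Hypothesis char2 : 2%N \in [pchar E].

(** The Cauchy-Binet formula without the index pairs {0, 2} and {1, 3}: isotropy makes their
    contributions equal, so they cancel modulo 2. *)
Lemma cauchy_binet_mod2 (a0 a1 a2 a3 b0 b1 b2 b3 c0 c1 c2 c3 d0 d1 d2 d3 : E) :
  a0 * b2 - a2 * b0 + (a1 * b3 - a3 * b1) = 0 ->
  c0 * d2 - c2 * d0 + (c1 * d3 - c3 * d1) = 0 ->
  (a0 * c0 + a1 * c1 + a2 * c2 + a3 * c3) * (b0 * d0 + b1 * d1 + b2 * d2 + b3 * d3) -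
  (a0 * d0 + a1 * d1 + a2 * d2 + a3 * d3) * (b0 * c0 + b1 * c1 + b2 * c2 + b3 * c3) =
  (a0 * b1 - a1 * b0) * (c0 * d1 - d0 * c1) + (a0 * b3 - a3 * b0) * (c0 * d3 - d0 * c3) +
  (a2 * b3 - a3 * b2) * (c2 * d3 - d2 * c3) + (a1 * b2 - a2 * b1) * (c1 * d2 - d1 * c2).
Proof.
move=> /eqP; rewrite addr_eq0 => /eqP ab /eqP; rewrite addr_eq0 => /eqP cd.
have /eqP : (a0 * b2 - a2 * b0) * (c0 * d2 - c2 * d0) +
    (a1 * b3 - a3 * b1) * (c1 * d3 - c3 * d1) = 0.
  by rewrite ab cd mulrNN addrr_pchar2.
move=> /eqP h; rewrite -[RHS]addr0 -h; ring.
Qed.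

Definition minor (A : 'M[E]_4) i1 i2 j1 j2 := A i1 j1 * A i2 j2 - A i1 j2 * A i2 j1.

Lemma minorCl A i1 i2 j1 j2 : minor A i2 i1 j1 j2 = minor A i1 i2 j1 j2.
Proof. by rewrite -[RHS](oppr_pchar2 char2) /minor; ring. Qed.

Definition wedge1 (i : 'I_4) := (wedge_basis i).1.
Definition wedge2 (i : 'I_4) := (wedge_basis i).2.

Lemma Sp4_isogenyE (A : 'M[E]_4) i j :
  Sp4_isogeny A i j = minor A (wedge1 i) (wedge2 i) (wedge1 j) (wedge2 j).
Proof.
by rewrite mxE /wedge1 /wedge2; case: (wedge_basis i); case: (wedge_basis j).
Qed.

Lemma wedge_basisE : [/\ wedge_basis (o 0) = (o 0, o 1),
  wedge_basis (o 1) = (o 0, o 3), wedge_basis (o 2) = (o 2, o 3)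
  & wedge_basis (o 3) = (o 1, o 2)].
Proof. by split; rewrite /wedge_basis (tnth_nth (o 0, o 0)) inordK. Qed.

Lemma wedge1E : [/\ wedge1 (o 0) = o 0, wedge1 (o 1) = o 0, wedge1 (o 2) = o 2
  & wedge1 (o 3) = o 1].
Proof. by have [e0 e1 e2 e3] := wedge_basisE; rewrite /wedge1 e0 e1 e2 e3. Qed.

Lemma wedge2E : [/\ wedge2 (o 0) = o 1, wedge2 (o 1) = o 3, wedge2 (o 2) = o 3
  & wedge2 (o 3) = o 2].
Proof. by have [e0 e1 e2 e3] := wedge_basisE; rewrite /wedge2 e0 e1 e2 e3. Qed.

Lemma wedge_isotropic i : symplectic_form E 2 (wedge1 i) (wedge2 i) = 0.
Proof.
have [a0 a1 a2 a3] := wedge1E; have [b0 b1 b2 b3] := wedge2E.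
elim/ord4_ind: i; rewrite ?(a0, a1, a2, a3) ?(b0, b1, b2, b3) symplectic_form4E;
  by rewrite !inordK //= subrr.
Qed.

Lemma symplectic_pairing (A : 'M[E]_4) : symplectic (n := 2) A ->
  forall i j, row_pairing A i j = symplectic_form E 2 i j.
Proof. by move=> /symplecticP AJ i j; rewrite -row_pairingE AJ. Qed.

Lemma symplectic4P (A : 'M[E]_4) :
  (forall i j, row_pairing A i j = symplectic_form E 2 i j) -> symplectic (n := 2) A.
Proof.
by move=> AJ; apply/symplecticP/matrixP => i j; rewrite -AJ -row_pairingE.
Qed.

Lemma symplectic_trmx (A : 'M[E]_4) :
  symplectic (n := 2) A -> symplectic (n := 2) A^T.
Proof. by move=> AJ; apply/symplecticP; rewrite trmxK. Qed.

Lemma Sp4_isogenyM (A B : 'M[E]_4) :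
  symplectic (n := 2) A -> symplectic (n := 2) B ->
  Sp4_isogeny (A *m B) = Sp4_isogeny A *m Sp4_isogeny B.
Proof.
move=> /symplectic_pairing pA /symplectic_trmx/symplectic_pairing pB.
apply/matrixP => i j; rewrite Sp4_isogenyE /minor !mxE !sum_ord4 !Sp4_isogenyE.
have [-> -> -> ->] := wedge1E; have [-> -> -> ->] := wedge2E.
apply: cauchy_binet_mod2; first by rewrite -(wedge_isotropic i) -pA.
by rewrite -(wedge_isotropic j) -pB /row_pairing !mxE; ring.
Qed.

(** Modulo 2 the left side is the Laplace expansion of the determinant of rows a, b, c, d, two terms
    of which cancel by isotropy; the right side is the Pfaffian of their Gram matrix. *)
Lemma plucker_mod2 (A : 'M[E]_4) a b c d :
  row_pairing A a b = 0 -> row_pairing A c d = 0 ->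
  minor A a b (o 0) (o 1) * minor A c d (o 2) (o 3) -
  minor A a b (o 2) (o 3) * minor A c d (o 0) (o 1) +
  (minor A a b (o 0) (o 3) * minor A c d (o 1) (o 2) -
   minor A a b (o 1) (o 2) * minor A c d (o 0) (o 3)) =
  row_pairing A a c * row_pairing A b d + row_pairing A a d * row_pairing A b c.
Proof.
move=> ab cd; pose x := minor A a b (o 2) (o 3) * minor A c d (o 0) (o 1) +
  minor A a b (o 1) (o 2) * minor A c d (o 0) (o 3) +
  minor A a b (o 0) (o 2) * minor A c d (o 0) (o 2) +
  row_pairing A a d * row_pairing A b c.
transitivity (row_pairing A a c * row_pairing A b d +
  row_pairing A a d * row_pairing A b c - row_pairing A a b * row_pairing A c d +
  minor A a b (o 0) (o 2) * row_pairing A c d +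
  minor A c d (o 0) (o 2) * row_pairing A a b - (x + x)).
  by rewrite /x /minor /row_pairing; ring.
by rewrite ab cd !mulr0 subr0 !addr0 addrr_pchar2 // subr0.
Qed.

Lemma Sp4_isogeny_symplectic (A : 'M[E]_4) :
  symplectic (n := 2) A -> symplectic (n := 2) (Sp4_isogeny A).
Proof.
move=> /symplectic_pairing pA; apply: symplectic4P => i j.
rewrite /row_pairing !Sp4_isogenyE.
have [a0 a1 a2 a3] := wedge1E; have [b0 b1 b2 b3] := wedge2E.
rewrite a0 a1 a2 a3 b0 b1 b2 b3 plucker_mod2 ?pA ?wedge_isotropic //.
elim/ord4_ind: i; rewrite ?(a0, a1, a2, a3) ?(b0, b1, b2, b3);
  elim/ord4_ind: j; rewrite ?(a0, a1, a2, a3) ?(b0, b1, b2, b3);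
  by rewrite !symplectic_form4E !inordK //= ?subrr ?sub0r ?subr0 ?(oppr_pchar2 char2)
    ?mulr0 ?mul0r ?mulr1 ?addr0 ?add0r.
Qed.

(** The index p lies in exactly two pairs of [wedge_basis], those numbered [wedge1 p] and
    [wedge2 p]; [shared1 p] and [shared2 p] are its partners there. *)
Definition shared1 (p : 'I_4) : 'I_4 := tnth [tuple o 1; o 0; o 3; o 0] p.
Definition shared2 (p : 'I_4) : 'I_4 := tnth [tuple o 3; o 2; o 1; o 2] p.

Lemma shared1E : [/\ shared1 (o 0) = o 1, shared1 (o 1) = o 0, shared1 (o 2) = o 3
  & shared1 (o 3) = o 0].
Proof. by split; rewrite /shared1 (tnth_nth (o 0)) inordK. Qed.

Lemma shared2E : [/\ shared2 (o 0) = o 3, shared2 (o 1) = o 2, shared2 (o 2) = o 1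
  & shared2 (o 3) = o 2].
Proof. by split; rewrite /shared2 (tnth_nth (o 0)) inordK. Qed.

Lemma minor_wedge1l A p j1 j2 : minor A (wedge1 (wedge1 p)) (wedge2 (wedge1 p)) j1 j2 =
  minor A p (shared1 p) j1 j2.
Proof.
have [a0 a1 a2 a3] := wedge1E; have [b0 b1 b2 b3] := wedge2E.
have [c0 c1 c2 c3] := shared1E.
by elim/ord4_ind: p; rewrite !(a0, a1, a2, a3) ?(b0, b1, b2, b3) ?(c0, c1, c2, c3) //
  minorCl.
Qed.

Lemma minor_wedge2l A p j1 j2 : minor A (wedge1 (wedge2 p)) (wedge2 (wedge2 p)) j1 j2 =
  minor A p (shared2 p) j1 j2.
Proof.
have [a0 a1 a2 a3] := wedge1E; have [b0 b1 b2 b3] := wedge2E.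
have [c0 c1 c2 c3] := shared2E.
by elim/ord4_ind: p; rewrite !(b0, b1, b2, b3) ?(a0, a1, a2, a3) ?(b0, b1, b2, b3)
  ?(c0, c1, c2, c3) // minorCl.
Qed.

Lemma minor_trmx A i1 i2 j1 j2 : minor A^T i1 i2 j1 j2 = minor A j1 j2 i1 i2.
Proof. by rewrite /minor !mxE; ring. Qed.

Lemma minor_wedge1r A i1 i2 q : minor A i1 i2 (wedge1 (wedge1 q)) (wedge2 (wedge1 q)) =
  minor A i1 i2 q (shared1 q).
Proof. by rewrite -minor_trmx minor_wedge1l minor_trmx. Qed.

Lemma minor_wedge2r A i1 i2 q : minor A i1 i2 (wedge1 (wedge2 q)) (wedge2 (wedge2 q)) =
  minor A i1 i2 q (shared2 q).
Proof. by rewrite -minor_trmx minor_wedge2l minor_trmx. Qed.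

Definition minor3 (A : 'M[E]_4) x y z u v w :=
  A x u * minor A y z v w - A x v * minor A y z u w + A x w * minor A y z u v.

(* Contracting the 3-vector of three rows with the symplectic form computes    *)
(* the 3 x 3 minors.                                                           *)
Lemma minor3_contract A x y z u :
  minor3 A x y z u (shared1 u) (shared2 u) =
  row_pairing A y z * A x u + row_pairing A x z * A y u + row_pairing A x y * A z u.
Proof.
have oppE (t : E) : - t = t := oppr_pchar2 char2 t.
transitivity (row_pairing A y z * A x u - row_pairing A x z * A y u +
  row_pairing A x y * A z u); last by rewrite -[- (_ * A y u)]oppE opprK.
have [c0 c1 c2 c3] := shared1E; have [d0 d1 d2 d3] := shared2E.
elim/ord4_ind: u; rewrite ?(c0, c1, c2, c3) ?(d0, d1, d2, d3) /minor3 /minor /row_pairing.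
- ring.
- ring.
- rewrite -[LHS]oppE; ring.
- ring.
Qed.

(** A 2 x 2 determinant of minors sharing row p and column q is A p q times the 3 x 3 minor on p, q
    and their partners. By contraction that minor is again A p q, since the partners of p are paired
    with each other and orthogonal to p. *)
Lemma Sp4_isogeny_sqr (A : 'M[E]_4) : symplectic (n := 2) A ->
  Sp4_isogeny (Sp4_isogeny A) = map_mx (fun x => x ^+ 2) A.
Proof.
move=> /symplectic_pairing pA; apply/matrixP => p q.
rewrite Sp4_isogenyE [LHS]/minor !Sp4_isogenyE.
rewrite !(minor_wedge1l, minor_wedge2l) !(minor_wedge1r, minor_wedge2r).
transitivity (A p q * minor3 A p (shared1 p) (shared2 p) q (shared1 q) (shared2 q)).
  by rewrite /minor3 /minor; ring.
rewrite minor3_contract !pA [RHS]mxE expr2; congr (_ * _).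
have [c0 c1 c2 c3] := shared1E; have [d0 d1 d2 d3] := shared2E.
elim/ord4_ind: p; rewrite ?(c0, c1, c2, c3) ?(d0, d1, d2, d3) !symplectic_form4E;
  by rewrite !inordK //= ?subrr ?sub0r ?subr0 ?(oppr_pchar2 char2) !mul0r mul1r !addr0.
Qed.

End CharacteristicTwo.

Lemma map_Sp4_isogeny (E E' : fieldType) (phi : {rmorphism E -> E'}) (A : 'M[E]_4) :
  map_mx phi (Sp4_isogeny A) = Sp4_isogeny (map_mx phi A).
Proof.
apply/matrixP => i j; rewrite mxE !Sp4_isogenyE /minor !mxE.
by rewrite rmorphB !rmorphM.
Qed.

Lemma map_Sp4_twisted_Frobenius m (E E' : fieldType) (phi : {rmorphism E -> E'})
    (A : 'M[E]_4) :
  map_mx phi (Sp4_twisted_Frobenius m A) = Sp4_twisted_Frobenius m (map_mx phi A).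
Proof.
by rewrite /Sp4_twisted_Frobenius -map_Sp4_isogeny rmorph_powerC.
Qed.

(** A symplectic basis u1, u2, v1, v2 gives the rows of U: v1 is dual to u1, u2 is a nonzero vector
    orthogonal to both, and v2 is dual to u2. *)
Lemma darboux4 (M : fieldType) (T : 'M[M]_4) : T \in unitmx ->
  (forall i j, T i j = - T j i) -> (forall i, T i i = 0) ->
  exists U : 'M[M]_4, U *m T *m U^T = symplectic_form M 2.
Proof.
move=> uT antiT altT.
pose b (u v : 'rV[M]_4) := (u *m T *m v^T) 0 0.
have bDr u v w : b u (v + w) = b u v + b u w.
  by rewrite /b raddfD mulmxDr mxE.
have bZr u c v : b u (c *: v) = c * b u v.
  by rewrite /b linearZ /= -scalemxAr mxE.
have bC u v : b u v = - b v u.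
  have TT : T^T = - T by apply/matrixP => i j; rewrite !mxE.
  rewrite /b -[LHS]/((fun A : 'M[M]_1 => A 0 0) _) -[u *m T *m v^T]trmxK mxE.
  by rewrite !trmx_mul trmxK TT mulmxA mulmxN mulNmx mxE.
have balt u : b u u = 0.
  rewrite /b !mxE sum_ord4 !mxE !sum_ord4 !altT.
  rewrite (antiT (o 1) (o 0)) (antiT (o 2) (o 0)) (antiT (o 3) (o 0)).
  by rewrite (antiT (o 2) (o 1)) (antiT (o 3) (o 1)) (antiT (o 3) (o 2)); ring.
have dual u : u != 0 -> exists v, b u v = 1.
  move=> u0; have /rV0Pn[j uj] : u *m T != 0.
    by apply: contraNneq u0 => uT0; rewrite -[u](mulmxK uT) uT0 mul0mx.
  exists (((u *m T) 0 j)^-1 *: delta_mx 0 j); rewrite bZr /b trmx_delta -colE [col _ _ _ _]mxE.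
  by rewrite mulVf.
pose u1 : 'rV[M]_4 := delta_mx 0 0.
have [v1 uv1] : exists v, b u1 v = 1.
  by apply: dual; apply/rV0Pn; exists 0; rewrite mxE !eqxx oner_neq0.
have /rowV0Pn[u2 /sub_kermxP u2k u20] : kermx (T *m row_mx u1^T v1^T) != 0.
  rewrite kermx_eq0 /row_free neq_ltn (leq_ltn_trans (rank_leq_col _)) //.
have [bu21 bu2v1] : b u2 u1 = 0 /\ b u2 v1 = 0.
  move: u2k; rewrite mulmxA mul_mx_row -[0]row_mx0 => /eq_row_mx[h1 h2].
  by rewrite /b h1 h2 mxE.
have [w uw] := dual u2 u20.
(* The correction makes v2 orthogonal to u1 and v1 and, as u2 is orthogonal to both, keeps its
   pairing with u2. *)
pose v2 := w + (- b w v1) *: u1 + b w u1 *: v1.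
have bv2u1 : b u1 v2 = 0.
  by rewrite !bDr !bZr balt uv1 mulr0 addr0 mulr1 [b w u1]bC subrr.
have bv2v1 : b v1 v2 = 0.
  by rewrite !bDr !bZr balt mulr0 addr0 [b v1 u1]bC uv1 mulrNN mulr1 [b v1 w]bC addNr.
have bu2v2 : b u2 v2 = 1.
  by rewrite !bDr !bZr bu21 bu2v1 !mulr0 !addr0.
pose U : 'M[M]_4 := \matrix_i tnth [tuple u1; u2; v1; v2] i.
exists U; apply/matrixP => i j.
have -> : (U *m T *m U^T) i j = b (row i U) (row j U).
  rewrite /b !mxE; apply: eq_bigr => l _; rewrite !mxE; congr (_ * _).
  by apply: eq_bigr => l' _; rewrite !mxE.
have rU : [/\ row (o 0) U = u1, row (o 1) U = u2, row (o 2) U = v1 & row (o 3) U = v2].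
  by split; rewrite rowK (tnth_nth 0) inordK.
have [r0 r1 r2 r3] := rU; rewrite symplectic_form4E.
have bV u v c : b u v = c -> b v u = - c by rewrite [b v u]bC => ->.
elim/ord4_ind: i; rewrite ?(r0, r1, r2, r3); elim/ord4_ind: j;
  rewrite ?(r0, r1, r2, r3) !inordK //= ?subrr ?sub0r ?subr0 ?balt //;
  by rewrite ?(bV _ _ _ bu21) ?(bV _ _ _ bu2v1) ?(bV _ _ _ bv2u1) ?(bV _ _ _ bv2v1)
    ?(bV _ _ _ uv1) ?(bV _ _ _ bu2v2) ?oppr0.
Qed.

(** The twisted Frobenius map sigma is shown multiplicative on symplectic matrices, whence the
    passage from X to Z = U X, with U over k(T) supplied by [darboux4]. As sigma^2 = F there,
    sigma(Z) = W Z gives F(Z) = sigma(W) W Z, hence an equation for X. The generators number 6 for T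
    and 10 for W, which is symplectic. *)
Lemma suzuki_lang_data (k : fieldType) (m : nat) (F : finFieldType)
    (eps : {rmorphism F -> k}) (gT : finGroupType) (G : {group gT})
    (rho : mx_representation k G 4) : 2%N \in [pchar k] ->
  #|F| = (2 ^ m.*2.+1)%N ->
  (forall A, suzuki m A <-> exists2 g, g \in G & rho g = A) ->
  lang_data rho eps.
Proof.
move=> char2k cardF SzP E iota X uX.
have char2 : 2%N \in [pchar E] by rewrite (fmorph_pchar iota).
have [phi phiE] : exists phi : {rmorphism E -> E}, forall x, phi x = x ^+ (2 ^ m).
  by apply: power_rmorphism; rewrite pnatX pnatE ?char2.
pose J : 'M[E]_4 := symplectic_form E 2.
have mapJ (f : {rmorphism E -> E}) : map_mx f J = J := map_symplectic_form f 2.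
have iotaJ : map_mx iota (symplectic_form k 2) = J := map_symplectic_form iota 2.
pose sigma (A : 'M[E]_4) := Sp4_twisted_Frobenius m A.
have sigmaE A : sigma A = map_mx phi (Sp4_isogeny A).
  by apply/matrixP => i j; rewrite !mxE phiE.
have sigmaM A B : symplectic (n := 2) A -> symplectic (n := 2) B ->
    sigma (A *m B) = sigma A *m sigma B.
  by move=> sA sB; rewrite !sigmaE Sp4_isogenyM // map_mxM.
have sigma_symp A : symplectic (n := 2) A -> symplectic (n := 2) (sigma A).
  move=> /(Sp4_isogeny_symplectic char2) sA; rewrite /symplectic sigmaE.
  by rewrite map_trmx -(map_symplectic_form phi 2) -!map_mxM sA.
have sigma_sqr A : symplectic (n := 2) A ->
    sigma (sigma A) = map_mx (fun x => x ^+ #|F|) A.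
  move=> sA; rewrite sigmaE [sigma A]sigmaE -map_Sp4_isogeny Sp4_isogeny_sqr //.
  apply/matrixP => i j; rewrite !mxE !phiE -!exprM cardF.
  by rewrite -expnD -expnS addnn.
have symp_unit (A : 'M[E]_4) : symplectic (n := 2) A -> A \in unitmx.
  exact: symplectic_unitmx.
pose T := X *m J *m X^T.
have uT : T \in unitmx by rewrite !unitmx_mul unitmx_tr uX (symplectic_form_unit E 2).
have [antiT altT] : (forall i j, T i j = - T j i) /\ forall i, T i i = 0.
  exact: (symplectic_alternating (X : 'M[E]_(4, 2 + 2))).
have [s1 [size1 s1T gT_]] := gen_alternating antiT altT.
pose S1 := adjoins (constant iota) s1.
have [U [gU UTU]] : exists U : 'M[E]_4, gen_mx S1 U /\ U *m T *m U^T = J.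
  have [M [iM genE]] := gen_field S1.
  have [T' T'E] := gen_lift_mx genE (gT_ (constant iota)).
  have [|i j|i|U' U'E] := @darboux4 M T'.
  - by rewrite -(map_unitmx iM) T'E.
  - apply: (fmorph_inj iM); rewrite rmorphN.
    have := antiT i j; rewrite -T'E !mxE; exact.
  - by apply: (fmorph_inj iM); rewrite rmorph0; have := altT i; rewrite -T'E !mxE.
  exists (map_mx iM U'); split=> [i j|].
    by rewrite mxE; apply/genE; eexists.
  by rewrite /J -(map_symplectic_form iM) -U'E !map_mxM T'E -map_trmx.
pose Z := U *m X.
have uU : U \in unitmx.
  by have := symplectic_form_unit E 2; rewrite -/J -UTU !unitmx_mul => /andP[/andP[]].
have sympZ : symplectic (n := 2) Z.
  by apply/symplecticP; rewrite -[RHS]UTU /Z /T trmx_mul !mulmxA.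
have uZ := symp_unit _ sympZ.
have [W WE] : exists W, W = sigma Z *m invmx Z by eexists.
have WZ : W *m Z = sigma Z by rewrite WE mulmxKV.
have sympW : symplectic (n := 2) W.
  by rewrite WE; apply: symplecticM; [apply: sigma_symp|apply: symplecticV].
have gWJW : gen_mx S1 (W *m J *m W^T).
  move/symplecticP: (sympW) => ->; rewrite -(map_symplectic_form iota) => i j.
  by rewrite mxE; apply: gen_in; left; eexists.
have [|s2 [size2 s2W gW]] := gen_matrix_gram (symp_unit _ sympW)
    (symplectic_form_unit E 2) _ gWJW.
  rewrite -(map_symplectic_form iota) => i j.
  by rewrite mxE; apply: gen_in; left; eexists.
have gS z : gen (adjoins S1 s2) z -> gen (adjoins (constant iota) (s1 ++ s2)) z.
  exact: gen_adjoins_cat.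
pose S := adjoins (constant iota) (s1 ++ s2).
have gUS : gen_mx S U by move=> i j; apply: gS; apply: gen_adjoins.
have gWS : gen_mx S W by move=> i j; apply: gS.
have g_sigma L A : gen_mx L A -> gen_mx L (sigma A).
  move=> gA i j; rewrite mxE Sp4_isogenyE /minor; apply: genX.
  by apply: genB; apply: genM.
pose UQ := map_mx (fun x => x ^+ #|F|) U.
have [Phi PhiE] := power_rmorphism (card_pchar_nat (iota \o eps)).
have eq_Phi (A : 'M[E]_4) : map_mx (fun x => x ^+ #|F|) A = map_mx Phi A.
  by apply/matrixP => i j; rewrite !mxE PhiE.
exists (s1 ++ s2), (invmx UQ *m (sigma W *m W) *m U); split.
- by rewrite size_cat addnC -sum_gram_alternating leq_add.
- move=> g alpha Gg ac aX; pose R := map_mx iota (rho g).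
  have [sg fg] := (SzP (rho g)).2 (ex_intro2 _ _ g Gg erefl).
  have sympR : symplectic (n := 2) R.
    by rewrite /symplectic /R map_trmx -(map_symplectic_form iota 2) -!map_mxM sg.
  have sigR : sigma R = R by rewrite /sigma -map_Sp4_twisted_Frobenius fg.
  have aT : map_mx alpha T = T.
    rewrite /T !map_mxM -map_trmx aX mapJ trmx_mul !mulmxA.
    have RJ : R *m J *m R^T = J := (symplecticP (n := 2) R).1 sympR.
    by rewrite -[X *m _ *m _]mulmxA -[X *m _ *m _]mulmxA RJ.
  have as1 y : y \in s1 -> alpha y = y.
    move=> /s1T[i [j ->]].
    by have := congr1 (fun M : 'M[E]_4 => M i j) aT; rewrite mxE.
  have aS1 z : gen S1 z -> alpha z = z.
    by apply: gen_fixed => w [[c <-]|/as1].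
  have aU : map_mx alpha U = U by apply/matrixP => i j; rewrite mxE aS1.
  have aZ : map_mx alpha Z = Z *m R by rewrite /Z map_mxM aU aX mulmxA.
  have aW : map_mx alpha W = W.
    rewrite WE map_mxM map_invmx /sigma map_Sp4_twisted_Frobenius aZ -/(sigma _).
    by rewrite sigmaM // sigR mulmx_invmx_cancel // symp_unit.
  move=> y; rewrite mem_cat => /orP[/as1 //|/s2W]; apply: gen_fixed => w.
  case=> [/gen_in/aS1 //|[i [j ->]]].
  by have := congr1 (fun M : 'M[E]_4 => M i j) aW; rewrite mxE.
- apply: gen_mulmx => //; apply: gen_mulmx; last by apply: gen_mulmx => //; apply: g_sigma.
  by apply: gen_invmx; apply: gen_power_mx.
- have uUQ : UQ \in unitmx by rewrite /UQ eq_Phi map_unitmx.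
  have ZQ : map_mx (fun x => x ^+ #|F|) Z = sigma W *m (W *m Z).
    by rewrite -sigma_sqr // WZ -sigmaM // WZ.
  apply: (can_inj (mulKmx uUQ)); rewrite -!mulmxA mulKVmx //.
  by rewrite -[RHS]ZQ /UQ !eq_Phi -map_mxM.
move=> C spC; pose R := map_mx (iota \o eps) C.
have RE : R = map_mx iota (map_mx eps C) by rewrite -map_mx_comp.
have sympR : symplectic (n := 2) R.
  have TC : (X *m R) *m J *m (X *m R)^T = T.
    apply: (special_eq_mx spC (H := fun C => (X *m map_mx (iota \o eps) C) *m J *m
      (X *m map_mx (iota \o eps) C)^T)) => //.
    - apply: corr_mulmx; last exact/corr_trmx/corr_mx_coord.
      apply: corr_mulmx; first exact: corr_mx_coord.
      apply: corr_mx_const; rewrite /J -(map_symplectic_form iota) => i j.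
      by rewrite mxE; apply: gen_in; left; eexists.
    - by move=> i j; apply: gS; apply: gen_adjoins; apply: gT_.
    - by rewrite map_scalar_mx rmorph1 mulmx1.
  have uXt : X^T \in unitmx by rewrite unitmx_tr.
  apply/symplecticP; apply: (can_inj (mulmxK uXt)); apply: (can_inj (mulKmx uX)).
  by rewrite [RHS]mulmxA -[RHS]TC trmx_mul !mulmxA.
have sigR : sigma R = R.
  (* The relation sigma(Z) = W Z is polynomial in X over the subfield, so it specializes to Z R;
     comparison with sigma(Z) sigma(R) yields sigma(R) = R. *)
  have ZC : sigma (U *m (X *m R)) - W *m (U *m (X *m R)) = 0.
    apply: (special_eq_mx spC (H := fun C =>
      sigma (U *m (X *m map_mx (iota \o eps) C)) -
      W *m (U *m (X *m map_mx (iota \o eps) C)))).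
    - have cU : corr_mx (iota \o eps) X S (fun C => U *m (X *m map_mx (iota \o eps) C)).
        by apply: corr_mulmx; [apply: corr_mx_const|apply: corr_mx_coord].
      have cN h : corr (iota \o eps) X S h -> corr (iota \o eps) X S (fun C => - h C).
        move=> ch; apply: corr_ext (corrM (corr_const _ _ (genN (gen1 S))) ch) => C'.
        by rewrite mulN1r.
      move=> i j; have cm a b c d : corr (iota \o eps) X S
          (fun C => minor (U *m (X *m map_mx (iota \o eps) C)) a b c d).
        exact: (corrD (corrM (cU a c) (cU b d)) (cN _ (corrM (cU a d) (cU b c)))).
      have := corrD (corrX (2 ^ m) (cm (wedge1 i) (wedge2 i) (wedge1 j) (wedge2 j)))
        (cN _ (corr_mulmx (corr_mx_const _ _ gWS) cU i j)).
      apply: corr_ext => C'; rewrite [RHS]mxE [X in _ = X + _]mxE.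
      by rewrite [X in _ = _ + X]mxE Sp4_isogenyE.
    - by move=> i j; rewrite mxE; apply: gen0.
    - by rewrite map_scalar_mx rmorph1 mulmx1 -/Z WZ subrr.
  have uWZ : W *m Z \in unitmx by rewrite unitmx_mul uZ symp_unit.
  apply: (can_inj (mulKmx uWZ)); apply/eqP; rewrite -subr_eq0 {1}WZ -sigmaM //.
  by rewrite /Z -!mulmxA ZC.
suff /SzP[g Gg <-] : suzuki m (map_mx eps C) by exists g.
split.
  apply: (map_mx_inj (f := iota)); rewrite !map_mxM -map_trmx -RE.
  by rewrite (map_symplectic_form iota).
by apply: (map_mx_inj (f := iota)); rewrite map_Sp4_twisted_Frobenius -RE.
Qed.

(** * Embedding a finite field into k *)

Lemma annihilator_generator (K L : fieldType) (f : {rmorphism K -> L}) (x : L)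
    (p : {poly K}) : p != 0 -> root (map_poly f p) x ->
  exists h : {poly K}, [/\ h != 0, root (map_poly f h) x &
    forall r, root (map_poly f r) x -> h %| r].
Proof.
have [n] := ubnP (size p); elim: n p => // n IHn p; rewrite ltnS => size_p p0 rp.
have [[r [r0 rr size_r]]|minp] := classic (exists r : {poly K},
    [/\ r != 0, root (map_poly f r) x & (size r < size p)%N]).
  exact: (IHn r (leq_trans size_r size_p)).
exists p; split=> // r rr; rewrite /dvdp; apply: contraT => r0; case: minp.
exists (r %% p); split=> //; last by rewrite ltn_modp.
have := congr1 (map_poly f) (divp_eq r p); rewrite rmorphD rmorphM /= => rE.
move: rr; rewrite rE rootE hornerD hornerM (rootP rp) mulr0 add0r.
by rewrite rootE.
Qed.

Lemma prime_field_embedding p (K : fieldType) :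
  p \in [pchar K] -> exists f : {rmorphism 'F_p -> K}, True.
Proof.
move=> pK.
by exists (in_alg (pPrimeCharType pK) : {rmorphism 'F_p -> pPrimeCharType pK}).
Qed.

(** A generator u of the cyclic unit group generates [F] over the prime field; it is sent to a root
    in [k] of its minimal polynomial. *)
Lemma finField_embedding p (F : finFieldType) (k : closedFieldType) :
  p \in [pchar F] -> p \in [pchar k] -> exists eps : {rmorphism F -> k}, True.
Proof.
move=> pF pk; have pr_p := pcharf_prime pF.
have [jF _] := prime_field_embedding pF; have [jk _] := prime_field_embedding pk.
have /cyclicP[u uE] := field_unit_group_cyclic [set: {unit F}].
pose ev (r : {poly 'F_p}) : F := (map_poly jF r).[FinRing.uval u].
have /fin_all_exists[P PE] x : exists r, ev r = x.
  have [->|x0] := eqVneq x 0; first by exists 0; rewrite /ev rmorph0 horner0.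
  have ux : x \is a GRing.unit by rewrite unitfE.
  have : FinRing.unit F ux \in <[u]>%g by rewrite -uE inE.
  case/cycleP=> i /(congr1 val) /= ->; exists 'X^i.
  by rewrite /ev map_polyXn hornerXn FinRing.val_unitX.
have evB r s : ev (r - s) = ev r - ev s by rewrite /ev rmorphB hornerD hornerN.
have [p0 [p00 rp0]] : exists p0 : {poly 'F_p}, p0 != 0 /\ root (map_poly jF p0) (FinRing.uval u).
  exists ('X^#|F| - 'X); split.
    rewrite -size_poly_eq0 size_polyDl ?size_polyXn //.
    by rewrite size_polyN size_polyX ltnS finNzRing_gt1.
  apply/rootP; rewrite -/(ev _) evB /ev map_polyXn map_polyX hornerXn hornerX.
  by rewrite expf_card subrr.
have [h [h0 rh hmin]] := annihilator_generator p00 rp0.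
have /closed_rootP[z /rootP rz] : size (map_poly jk h) != 1%N.
  rewrite size_map_poly; apply: contraTneq rh => /eqP/size_poly1P[c c0 ->].
  by rewrite map_polyC rootC fmorph_eq0.
pose evk (r : {poly 'F_p}) : k := (map_poly jk r).[z].
have evkE r s : ev r = ev s -> evk r = evk s.
  move=> rs; apply/eqP; rewrite -subr_eq0 /evk -hornerN -hornerD -rmorphB.
  have /hmin/dvdpP[t ->] : root (map_poly jF (r - s)) (FinRing.uval u).
    by rewrite rootE -/(ev _) evB rs subrr.
  by rewrite rmorphM hornerM rz mulr0.
pose eps x := evk (P x).
have epsB : zmod_morphism eps.
  move=> x y; rewrite /eps (evkE _ (P x - P y)) ?evB ?PE //.
  by rewrite /evk rmorphB hornerD hornerN.
have epsM : monoid_morphism eps.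
  split=> [|x y].
    by rewrite /eps (evkE _ 1) ?PE /ev /evk ?rmorph1 ?hornerC.
  rewrite /eps (evkE _ (P x * P y)) /evk ?rmorphM ?hornerM // PE /ev.
  by rewrite rmorphM hornerM -/(ev _) -/(ev _) !PE.
pose epsr : {rmorphism F -> k} := HB.pack eps
  (GRing.isZmodMorphism.Build _ _ eps epsB) (GRing.isMonoidMorphism.Build _ _ eps epsM).
by exists epsr.
Qed.

Theorem theorem1p2 (p e q : nat) (k : closedFieldType) (gT : finGroupType)
    (G : {group gT}) (d : nat) (rV : mx_representation k G d) :
  prime p -> (0 < e)%N -> q = (p ^ e)%N ->
  is_algebraic_closure_of_Fp p k ->
  SL_Sp_or_twisted k q G ->
  mx_faithful rV ->
  quotient_stably_rational rV.
Proof.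
move=> pr_p e0 qE [iota _] grp fV.
have pk : p \in [pchar k] by rewrite (fmorph_pchar iota) pchar_Fp.
have embed (F : finFieldType) i : #|F| = (p ^ i)%N -> exists eps : {rmorphism F -> k}, True.
  by move=> cardF; apply: (finField_embedding (card_finPcharP cardF pr_p) pk).
case: grp => [F n cardF n0 [rho frho rhoP]|F n cardF n0 [rho frho rhoP]
             |F n cardF n0 [rho frho rhoP]|m qm [rho frho rhoP]].
- have [eps _] := embed F e (etrans cardF qE).
  apply: (quotient_stably_rational_of_lang_data fV _ (SL_lang_data eps n0 rhoP)).
  by rewrite map_mx_faithful.
- have [eps _] := embed F e (etrans cardF qE).
  apply: (quotient_stably_rational_of_lang_data fV _ (Sp_lang_data eps rhoP)).
  by rewrite map_mx_faithful.
- have [eps _] := embed F (e * 2)%N (etrans cardF (etrans (congr1 (expn^~ 2) qE)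
    (esym (expnM p e 2)))).
  apply: (quotient_stably_rational_of_lang_data fV _ (SU_lang_data eps n0 cardF rhoP)).
  by rewrite map_mx_faithful.
(* q is both a positive power of p and a power of 2. *)
have p2 : p = 2%N.
  have : (p %| 2 ^ m.*2.+1)%N by rewrite -qm qE dvdn_exp.
  by rewrite Euclid_dvdX // dvdn_prime2 // => /andP[/eqP].
(* The Suzuki group is given inside Sp_4(k); the field with q elements has to be supplied for the
   Lang data. *)
have [F pF cardF] := pPrimePowerField (isT : prime 2) (ltn0Sn m.*2).
have [eps _] : exists eps : {rmorphism F -> k}, True.
  by apply: (@finField_embedding 2); rewrite // -p2.
apply: (quotient_stably_rational_of_lang_data fV frho
  (suzuki_lang_data eps _ cardF rhoP)).
by rewrite -p2.
Qed.
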